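(* Let $h'_1,h'_2,l'_1,l'_2,\alpha'_1,\alpha'_2,\beta'$ be such that $N:=(h'_1-h'_2-l'_1+l'_2+\alpha'_1-\alpha'_2+\beta'-2)/2$ is a non-negative integer, and assume $\beta'<0$ and $\alpha'_1<\alpha'_2$ (real). Let $c_n(E')$, $c(E')$ be the polynomials of the context built from $h''_1=l'_1,\ l''_1=h'_1,\ h''_2=h'_2,\ l''_2=l'_2,\ \alpha''_i=\alpha'_i,\ \beta''=\beta'$, and let $c(E'_0)=0$. Let $\alpha_1\in\mathbb{C}$ be arbitrary and define $\alpha_2=\alpha_1-\alpha'_1+\alpha'_2+h'_2-l'_2+1+N$, $\beta=h'_1-l'_1+\alpha'_1-\alpha'_2-1-N$, $l_1=l'_1$, $l_2=l'_2$, $h_1=h'_1-h'_2+l'_2-1-N$, $h_2=l'_2-1-N$, $E=q^{\alpha_1-\alpha'_1}E'_0$. Let $\xi\neq0$ be either independent of $x$ or of the form $\xi=Ax$ with $A$ independent of $x$, and assume $\xi$, $x$ are such that no factor in a denominator below vanishes. Then the series $$g_1(x)=(1-q)x^{-\alpha_1}\frac{(q^{-l'_1+1/2}\xi/t_1,\ q^{-h'_2+l'_2-N}\xi/x;q)_\infty}{(q^{-h'_1+1/2}\xi/t_1,\ \xi/x;q)_\infty}\sum_{n=-\infty}^{\infty}\frac{(q^{-h'_1+1/2}\xi/t_1,\ \xi/x;q)_n}{(q^{-l'_1+1/2}\xi/t_1,\ q^{-h'_2+l'_2-N}\xi/x;q)_n}\sum_{k=0}^{N}q^{(-\beta'+1+k)n}\xi^{-\beta'+1+k}c_k(E'_0),$$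 $$g_2(x)=(1-q)x^{-\alpha_1-h'_2+l'_2-N}\frac{(q^{h'_1+1/2}t_1/\xi,\ qx/\xi;q)_\infty}{(q^{l'_1+1/2}t_1/\xi,\ q^{h'_2-l'_2+N+1}x/\xi;q)_\infty}\sum_{n=-\infty}^{\infty}\frac{(q^{l'_1+1/2}t_1/\xi,\ q^{h'_2-l'_2+N+1}x/\xi;q)_n}{(q^{h'_1+1/2}t_1/\xi,\ qx/\xi;q)_n}\sum_{k=0}^{N}q^{(-\alpha'_1+\alpha'_2+1+N-k)n}\xi^{\alpha'_1-\alpha'_2-1-N+k}c_k(E'_0)$$ converge and satisfy $A^{\langle4\rangle}(x;h_1,h_2,l_1,l_2,\alpha_1,\alpha_2,\beta)g_i(x)=Eg_i(x)$ for $i=1,2$.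
   Context: $q\in\mathbb{C}$ with $0<|q|<1$; powers $q^{a}$ via a fixed branch of $\log q$ (so for real $a$, $|q^a|=|q|^a$), $x^a,\xi^a$ fixed branches. $(a;q)_\infty=\prod_{k\ge0}(1-aq^k)$, $(a;q)_n=(a;q)_\infty/(aq^n;q)_\infty$ for all $n\in\mathbb{Z}$, $(a_1,\dots,a_m;q)_n=\prod_i(a_i;q)_n$. $t_1,t_2$ fixed non-zero constants; $T_x^{\pm1}g(x)=g(q^{\pm1}x)$; $A^{\langle 4\rangle}(x;h_1,h_2,l_1,l_2,\alpha_1,\alpha_2,\beta)=x^{-1}(x-q^{h_1+1/2}t_1)(x-q^{h_2+1/2}t_2)T_x^{-1}+q^{\alpha_1+\alpha_2}x^{-1}(x-q^{l_1-1/2}t_1)(x-q^{l_2-1/2}t_2)T_x-\{(q^{\alpha_1}+q^{\alpha_2})x+q^{(h_1+h_2+l_1+l_2+\alpha_1+\alpha_2)/2}(q^{\beta/2}+q^{-\beta/2})t_1t_2x^{-1}\}$. Polynomials: given $(h''_1,h''_2,l''_1,l''_2,\alpha''_1,\alpha''_2,\beta'')$ and $N$ with $\beta''\notin\{1,\dots,N\}$, put $\lambda''_1=(h''_1+h''_2-l''_1-l''_2-\alpha''_1-\alpha''_2-\beta''+2)/2$, $x''_n=t_1t_2q^{1-n+h''_1+h''_2-\lambda''_1}(1-q^{n})(1-q^{n-\beta''})$, $y''_n=q^{3/2-n-\lambda''_1}(q^{h''_1}t_1+q^{h''_2}t_2)+q^{n-3/2+\lambda''_1+\alpha''_1+\alpha''_2}(q^{l''_1}t_1+q^{l''_2}t_2)$,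 $z''_n=q^{2-n-\lambda''_1}(1-q^{n-2+\lambda''_1+\alpha''_1})(1-q^{n-2+\lambda''_1+\alpha''_2})$; $c_{-1}=0$, $c_0=1$, $c_n(E'')x''_n=c_{n-1}(E'')(E''+y''_n)-c_{n-2}(E'')z''_n$ ($1\le n\le N$), $c(E'')=x''_1\cdots x''_N[c_N(E'')(E''+y''_{N+1})-c_{N-1}(E'')z''_{N+1}]$. *)

(* Defs.v *)
From Stdlib Require Import Reals ZArith.
From Coquelicot Require Import Coquelicot.
Open Scope C_scope.

Definition Cexp (z : C) : C :=
  (exp (fst z) * cos (snd z), exp (fst z) * sin (snd z))%R.

Definition Czero : C := RtoC 0.
Definition Cone : C := RtoC 1.
Definition Chalf : C := RtoC (/ 2).

(* powers with a fixed logarithm:  b^a := exp (a * log b), lb a log of b *)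
Definition cpow (lb a : C) : C := Cexp (a * lb).

Fixpoint csum (f : nat -> C) (n : nat) : C :=
  match n with O => f O | S m => csum f m + f (S m) end.
Fixpoint cprod1 (f : nat -> C) (n : nat) : C :=
  match n with O => Cone | S m => cprod1 f m * f (S m) end.

Definition qpow (lq : C) (k : Z) : C := Cexp (RtoC (IZR k) * lq).
Fixpoint qpoch (lq a : C) (n : nat) : C :=
  match n with O => Cone | S m => qpoch lq a m * (Cone - a * qpow lq (Z.of_nat m)) end.
Definition qinf (lq a : C) : C :=
  (real (Lim_seq (fun n => fst (qpoch lq a n))),
   real (Lim_seq (fun n => snd (qpoch lq a n)))).
(* (a;q)_n for n : Z;  for n < 0 it is 1 / prod_{k=1}^{-n} (1 - a q^{-k}),
   which is (a;q)_oo / (a q^n;q)_oo whenever the latter is defined *)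
Definition qpochZ (lq a : C) (n : Z) : C :=
  match n with
  | Z0 => Cone
  | Zpos p => qpoch lq a (Pos.to_nat p)
  | Zneg p => / cprod1 (fun k => Cone - a * qpow lq (- Z.of_nat k)) (Pos.to_nat p)
  end.

Definition bconv (f : Z -> C) : Prop :=
  ex_series (V := C_NormedModule) (fun n => f (Z.of_nat n)) /\
  ex_series (V := C_NormedModule) (fun n => f (- Z.of_nat (S n))%Z).
Definition bsum (f : Z -> C) : C :=
  (Series (fun n => fst (f (Z.of_nat n))) + Series (fun n => fst (f (- Z.of_nat (S n))%Z)),
   Series (fun n => snd (f (Z.of_nat n))) + Series (fun n => snd (f (- Z.of_nat (S n))%Z)))%R.

Section Poly.
Variables (lq t1 t2 h1 h2 l1 l2 al1 al2 be E : C).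
Let qq (a : C) := cpow lq a.
Let nC (n : nat) : C := RtoC (INR n).
Definition lam1 : C := (h1 + h2 - l1 - l2 - al1 - al2 - be + RtoC 2) / RtoC 2.
Definition xpp (n : nat) : C :=
  t1 * t2 * qq (Cone - nC n + h1 + h2 - lam1) * (Cone - qq (nC n)) * (Cone - qq (nC n - be)).
Definition ypp (n : nat) : C :=
  qq (RtoC (3/2) - nC n - lam1) * (qq h1 * t1 + qq h2 * t2)
  + qq (nC n - RtoC (3/2) + lam1 + al1 + al2) * (qq l1 * t1 + qq l2 * t2).
Definition zpp (n : nat) : C :=
  qq (RtoC 2 - nC n - lam1) * (Cone - qq (nC n - RtoC 2 + lam1 + al1))
                            * (Cone - qq (nC n - RtoC 2 + lam1 + al2)).
(* cpair n = (c_{n-1}(E), c_n(E)) *)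
Fixpoint cpair (n : nat) : C * C :=
  match n with
  | O => (Czero, Cone)
  | S m => let (p, c) := cpair m in
           (c, (c * (E + ypp (S m)) - p * zpp (S m)) / xpp (S m))
  end.
Definition cn (n : nat) : C := snd (cpair n).
Definition cpoly (N : nat) : C :=
  cprod1 xpp N * (snd (cpair N) * (E + ypp (S N)) - fst (cpair N) * zpp (S N)).
End Poly.

(* g : C -> C is a function of u, x = Cexp u, and T_x^{+-1} is u |-> u +- lq *)
Definition A4 (lq t1 t2 h1 h2 l1 l2 al1 al2 be : C) (g : C -> C) (u : C) : C :=
  let x := Cexp u in
  let qq := cpow lq in
  / x * (x - qq (h1 + Chalf) * t1) * (x - qq (h2 + Chalf) * t2) * g (u - lq)
  + qq (al1 + al2) * / x * (x - qq (l1 - Chalf) * t1) * (x - qq (l2 - Chalf) * t2) * g (u + lq)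
  - ((qq al1 + qq al2) * x
     + qq ((h1 + h2 + l1 + l2 + al1 + al2) / RtoC 2) * (qq (be / RtoC 2) + qq (- be / RtoC 2))
       * t1 * t2 * / x) * g u.

(* Parameters: lq = log q; h1' h2' l1' l2' complex; a1' a2' b' real (alpha'_1,
   alpha'_2, beta'); N; E0 = E'_0; al1 = alpha_1; vxi u = log xi at x = Cexp u. *)
Definition cc (lq t1 t2 h1' h2' l1' l2' : C) (a1' a2' b' : R) (E0 : C) (k : nat) : C :=
  (* c_k(E'_0) with h''_1 = l'_1, h''_2 = h'_2, l''_1 = h'_1, l''_2 = l'_2,
     alpha''_i = alpha'_i, beta'' = beta' *)
  cn lq t1 t2 l1' h2' h1' l2' (RtoC a1') (RtoC a2') (RtoC b') E0 k.

Definition NC (N : nat) : C := RtoC (INR N).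

Definition g1a1 lq t1 (h1' : C) vxi (u : C) : C := cpow lq (- h1' + Chalf) * Cexp (vxi u) / t1.
Definition g1a2 (vxi : C -> C) (u : C) : C := Cexp (vxi u) / Cexp u.
Definition g1b1 lq t1 (l1' : C) vxi (u : C) : C := cpow lq (- l1' + Chalf) * Cexp (vxi u) / t1.
Definition g1b2 lq (h2' l2' : C) (N : nat) vxi (u : C) : C :=
  cpow lq (- h2' + l2' - NC N) * Cexp (vxi u) / Cexp u.

Definition g1term (lq t1 t2 h1' h2' l1' l2' : C) (a1' a2' b' : R) (N : nat) (E0 : C)
    (vxi : C -> C) (u : C) (n : Z) : C :=
  let a1 := g1a1 lq t1 h1' vxi u in
  let a2 := g1a2 vxi u in
  let b1 := g1b1 lq t1 l1' vxi u in
  let b2 := g1b2 lq h2' l2' N vxi u in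
  qpochZ lq a1 n * qpochZ lq a2 n / (qpochZ lq b1 n * qpochZ lq b2 n)
  * csum (fun k => cpow lq ((- RtoC b' + Cone + RtoC (INR k)) * RtoC (IZR n))
                   * Cexp ((- RtoC b' + Cone + RtoC (INR k)) * vxi u)
                   * cc lq t1 t2 h1' h2' l1' l2' a1' a2' b' E0 k) N.

Definition g1 (lq t1 t2 h1' h2' l1' l2' : C) (a1' a2' b' : R) (N : nat) (E0 al1 : C)
    (vxi : C -> C) (u : C) : C :=
  let a1 := g1a1 lq t1 h1' vxi u in
  let a2 := g1a2 vxi u in
  let b1 := g1b1 lq t1 l1' vxi u in
  let b2 := g1b2 lq h2' l2' N vxi u in
  (Cone - Cexp lq) * Cexp (- al1 * u) * (qinf lq b1 * qinf lq b2) / (qinf lq a1 * qinf lq a2)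
  * bsum (g1term lq t1 t2 h1' h2' l1' l2' a1' a2' b' N E0 vxi u).

(* no factor of a denominator in g_1 vanishes (at the point u = log x):
   the a_i occur in denominators as 1 - a_i q^k for all k in Z
   ((a_i;q)_oo in the prefactor, (a_i;q)_n with n < 0 in the sum), the b_i
   as 1 - b_i q^k for k >= 0 ((b_i;q)_n with n > 0 in the sum). *)
Definition nondeg1 lq t1 (h1' h2' l1' l2' : C) (N : nat) vxi (u : C) : Prop :=
  (forall k : Z, g1a1 lq t1 h1' vxi u * qpow lq k <> Cone /\ g1a2 vxi u * qpow lq k <> Cone) /\
  (forall k : nat, g1b1 lq t1 l1' vxi u * qpow lq (Z.of_nat k) <> Cone /\
                   g1b2 lq h2' l2' N vxi u * qpow lq (Z.of_nat k) <> Cone).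

Definition g2c1 lq t1 (h1' : C) vxi (u : C) : C := cpow lq (h1' + Chalf) * t1 / Cexp (vxi u).
Definition g2c2 lq (vxi : C -> C) (u : C) : C := Cexp lq * Cexp u / Cexp (vxi u).
Definition g2d1 lq t1 (l1' : C) vxi (u : C) : C := cpow lq (l1' + Chalf) * t1 / Cexp (vxi u).
Definition g2d2 lq (h2' l2' : C) (N : nat) vxi (u : C) : C :=
  cpow lq (h2' - l2' + NC N + Cone) * Cexp u / Cexp (vxi u).

Definition g2term (lq t1 t2 h1' h2' l1' l2' : C) (a1' a2' b' : R) (N : nat) (E0 : C)
    (vxi : C -> C) (u : C) (n : Z) : C :=
  let c1 := g2c1 lq t1 h1' vxi u in
  let c2 := g2c2 lq vxi u in
  let d1 := g2d1 lq t1 l1' vxi u in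
  let d2 := g2d2 lq h2' l2' N vxi u in
  qpochZ lq d1 n * qpochZ lq d2 n / (qpochZ lq c1 n * qpochZ lq c2 n)
  * csum (fun k => cpow lq ((- RtoC a1' + RtoC a2' + Cone + NC N - RtoC (INR k)) * RtoC (IZR n))
                   * Cexp ((RtoC a1' - RtoC a2' - Cone - NC N + RtoC (INR k)) * vxi u)
                   * cc lq t1 t2 h1' h2' l1' l2' a1' a2' b' E0 k) N.

Definition g2 (lq t1 t2 h1' h2' l1' l2' : C) (a1' a2' b' : R) (N : nat) (E0 al1 : C)
    (vxi : C -> C) (u : C) : C :=
  let c1 := g2c1 lq t1 h1' vxi u in
  let c2 := g2c2 lq vxi u in
  let d1 := g2d1 lq t1 l1' vxi u in
  let d2 := g2d2 lq h2' l2' N vxi u in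
  (Cone - Cexp lq) * Cexp ((- al1 - h2' + l2' - NC N) * u)
  * (qinf lq c1 * qinf lq c2) / (qinf lq d1 * qinf lq d2)
  * bsum (g2term lq t1 t2 h1' h2' l1' l2' a1' a2' b' N E0 vxi u).

Definition nondeg2 lq t1 (h1' h2' l1' l2' : C) (N : nat) vxi (u : C) : Prop :=
  (forall k : Z, g2d1 lq t1 l1' vxi u * qpow lq k <> Cone /\
                 g2d2 lq h2' l2' N vxi u * qpow lq k <> Cone) /\
  (forall k : nat, g2c1 lq t1 h1' vxi u * qpow lq (Z.of_nat k) <> Cone /\
                   g2c2 lq vxi u * qpow lq (Z.of_nat k) <> Cone).

(* Main.v *)
(* Write [s = xi q^n] and let [W(x, s)] be the ratio of infinite products in the [n]-th term of
   [g_1] or [g_2], prefactor included, so that [g_i = sum_n W(x, s) sum_k c_k s^(sigma + k)] up to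
   a power of [x].  The ratios [W(x q^(+-1), s) / W(x, s)] and [W(x, q s) / W(x, s)] are the same
   rational functions for [g_1] and [g_2] (with [s] running backwards for [g_2]).  For each [k],
   [A4] applied to [W s^(sigma + k)] equals, up to a difference in [s], the combination
   [q^(alpha_1 - alpha'_1) (x_k s^(-1) - y_(k+1) + z_(k+2) s)] of its neighbours.  The differences
   telescope to [0] because [beta' < 0] and [alpha'_1 < alpha'_2] make the boundary terms summable,
   and the recurrence for the [c_k], which terminates since [c(E'_0) = 0] and [z_(N+2) = 0], turns
   the rest into [E g_i].  If [xi = A x], the shift of [x] only translates the summation index. *)

Require Import Defs.
From Stdlib Require Import Reals ZArith Lra Lia.
From Coquelicot Require Import Coquelicot.
Open Scope C_scope.

(** The non-vanishing assumptions allow [W(x, s)] to be zero for some [n < 0], so its ratios cannot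
    be formed term by term. Instead one factor [Psi n] is split off that divides the values at
    [x/q], [x] and [q x], leaving polynomials in [s]. All that is used of [Psi] is a
    cross-multiplied first-order recurrence in [n], the same for both solutions. It gives the
    convergence of every auxiliary series and the telescoping alike. Since [xi] may depend on [x],
    the summand is treated as a function of two independent variables, [log x] and [log s]; [xi]
    only selects the starting point of the orbit of [s]. Every parameter enters through its power of
    [q]. The relation defining [N] is used to eliminate [q^beta'], after which the remaining
    identities are rational and decided by [field]. The summands have powers of [s] up to [N + 3],
    the boundary terms up to [N + 4]. With the worst power at each end, successive terms shrink like
    [q^(-beta')] towards [+oo] and like [q^(alpha'_2 - alpha'_1)] towards [-oo]; this is where the
    two inequalities enter. *)

(** * The complex exponential and integer powers of [q] *)

Lemma Cexp_plus (a b : C) : Cexp (a + b) = Cexp a * Cexp b.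
Proof.
  unfold Cexp, Cplus, Cmult; simpl.
  rewrite exp_plus, cos_plus, sin_plus; f_equal; ring.
Qed.

Lemma Cexp_0 : Cexp 0 = 1.
Proof. unfold Cexp, RtoC; simpl. rewrite exp_0, cos_0, sin_0; f_equal; ring. Qed.

Lemma Cmod_Cexp (z : C) : Cmod (Cexp z) = exp (fst z).
Proof.
  unfold Cmod, Cexp; simpl.
  replace (_ + _)%R with (exp (fst z) * exp (fst z))%R.
  - apply sqrt_square. left; apply exp_pos.
  - pose proof (sin2_cos2 (snd z)) as H. unfold Rsqr in H.
    transitivity (exp (fst z) * exp (fst z)
      * (sin (snd z) * sin (snd z) + cos (snd z) * cos (snd z)))%R; [rewrite H |]; ring.
Qed.

Lemma Cexp_neq_0 (z : C) : Cexp z <> 0.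
Proof. apply Cmod_gt_0. rewrite Cmod_Cexp. apply exp_pos. Qed.

Lemma Cexp_opp (z : C) : Cexp (- z) = / Cexp z.
Proof.
  pose proof (Cexp_neq_0 z).
  assert (E : Cexp (- z) * Cexp z = 1)
    by (rewrite <- Cexp_plus; replace (- z + z) with (RtoC 0) by ring; apply Cexp_0).
  transitivity (Cexp (- z) * Cexp z * / Cexp z); [field; assumption | rewrite E; ring].
Qed.

Lemma Cexp_minus (a b : C) : Cexp (a - b) = Cexp a / Cexp b.
Proof. unfold Cminus, Cdiv. rewrite Cexp_plus, Cexp_opp. reflexivity. Qed.

(** Inversion is total. With this value at 0 it is multiplicative and involutive without side
    conditions, so inverses of infinite products can be rearranged with no knowledge of their
    zeros. *)
Lemma Cinv_0 : / RtoC 0 = RtoC 0.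
Proof. unfold Cinv, RtoC; simpl. f_equal; unfold Rdiv; ring. Qed.

Lemma Cinv_neq_0 (a : C) : a <> 0 -> / a <> 0.
Proof.
  intros Ha E. apply C1_nz. rewrite <- (Cinv_r a Ha), E. ring.
Qed.

Lemma Cinv_mult (a b : C) : / (a * b) = / a * / b.
Proof.
  destruct (Ceq_dec a 0) as [-> | Ha]; [rewrite Cmult_0_l, Cinv_0; ring |].
  destruct (Ceq_dec b 0) as [-> | Hb]; [rewrite Cmult_0_r, Cinv_0; ring |].
  field; split; assumption.
Qed.

Lemma Cinv_inv (a : C) : / / a = a.
Proof.
  destruct (Ceq_dec a 0) as [-> | Ha]; [rewrite !Cinv_0; reflexivity | field; exact Ha].
Qed.

Lemma qpow_plus (lq : C) (m n : Z) : qpow lq (m + n) = qpow lq m * qpow lq n.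
Proof. unfold qpow. rewrite plus_IZR, RtoC_plus, Cmult_plus_distr_r. apply Cexp_plus. Qed.

Lemma qpow_0 (lq : C) : qpow lq 0 = 1.
Proof. unfold qpow. rewrite Cmult_0_l. apply Cexp_0. Qed.

Lemma qpow_1 (lq : C) : qpow lq 1 = Cexp lq.
Proof. unfold qpow. rewrite Cmult_1_l. reflexivity. Qed.

Lemma qpow_neq_0 (lq : C) (n : Z) : qpow lq n <> 0.
Proof. apply Cexp_neq_0. Qed.

Lemma qpow_of_nat (lq : C) (n : nat) : qpow lq (Z.of_nat n) = Cexp lq ^ n.
Proof.
  induction n as [| n IH]; [apply qpow_0 |].
  rewrite Nat2Z.inj_succ, <- Z.add_1_r, qpow_plus, IH, qpow_1, Cpow_S. ring.
Qed.

Lemma qpow_opp_mult (lq : C) (n : Z) : qpow lq (- n) * qpow lq n = 1.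
Proof. rewrite <- qpow_plus, Z.add_opp_diag_l. apply qpow_0. Qed.

(** * Bilateral series *)

Definition is_bsum (f : Z -> C) (l : C) : Prop := exists a b : C,
  is_series (V := C_NormedModule) (fun n => f (Z.of_nat n)) a /\
  is_series (V := C_NormedModule) (fun n => f (- Z.of_nat (S n))%Z) b /\
  l = a + b.

Lemma is_bsum_bconv (f : Z -> C) (l : C) : is_bsum f l -> bconv f.
Proof. intros (a & b & Ha & Hb & _). split; [exists a | exists b]; assumption. Qed.

Lemma bconv_is_bsum (f : Z -> C) : bconv f -> exists l, is_bsum f l.
Proof. intros [[a Ha] [b Hb]]. exists (a + b), a, b. auto. Qed.

Lemma sum_n_fst_snd (f : nat -> C) (n : nat) :
  sum_n (G := C_AbelianMonoid) f n = (sum_n (fun k => fst (f k)) n, sum_n (fun k => snd (f k)) n).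
Proof.
  induction n as [| n IH].
  - rewrite !sum_O. apply surjective_pairing.
  - rewrite !sum_Sn, IH. reflexivity.
Qed.

Lemma filterlim_C_fst_snd (f : nat -> C) (l : C) :
  filterlim f eventually (locally (T := C_UniformSpace) l) ->
  is_lim_seq (fun n => fst (f n)) (fst l) /\ is_lim_seq (fun n => snd (f n)) (snd l).
Proof.
  intros H. rewrite filterlim_locally in H.
  split; apply filterlim_locally; intros eps; specialize (H eps);
    revert H; apply filter_imp; intros n [H1 H2]; assumption.
Qed.

(** [bsum] adds real and imaginary parts separately by the total function [Series]; its value can be
    identified only after a complex series is split into these two real ones. *)
Lemma is_series_C (f : nat -> C) (l : C) :
  is_series (V := C_NormedModule) f l ->
  is_series (fun n => fst (f n)) (fst l) /\ is_series (fun n => snd (f n)) (snd l).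
Proof.
  intros H. destruct (filterlim_C_fst_snd _ _ H) as [H1 H2].
  split; [eapply filterlim_ext, H1 | eapply filterlim_ext, H2]; intros n;
    [exact (f_equal fst (sum_n_fst_snd f n)) | exact (f_equal snd (sum_n_fst_snd f n))].
Qed.

Lemma is_bsum_unique (f : Z -> C) (l : C) : is_bsum f l -> bsum f = l.
Proof.
  intros (a & b & Ha & Hb & ->).
  destruct (is_series_C _ _ Ha) as [Ha1 Ha2], (is_series_C _ _ Hb) as [Hb1 Hb2].
  unfold bsum.
  rewrite (is_series_unique _ _ Ha1), (is_series_unique _ _ Ha2),
    (is_series_unique _ _ Hb1), (is_series_unique _ _ Hb2).
  reflexivity.
Qed.

Lemma bconv_is_bsum_bsum (f : Z -> C) : bconv f -> is_bsum f (bsum f).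
Proof.
  intros H. destruct (bconv_is_bsum f H) as [l Hl].
  rewrite (is_bsum_unique f l Hl). exact Hl.
Qed.

Lemma is_bsum_ext (f g : Z -> C) (l : C) :
  (forall n, f n = g n) -> is_bsum f l -> is_bsum g l.
Proof.
  intros E (a & b & Ha & Hb & ->). exists a, b.
  split; [| split; [| reflexivity]]; eapply is_series_ext;
    [| exact Ha | | exact Hb]; intros n; apply E.
Qed.

Lemma is_bsum_plus (f g : Z -> C) (l m : C) :
  is_bsum f l -> is_bsum g m -> is_bsum (fun n => f n + g n) (l + m).
Proof.
  intros (a & b & Ha & Hb & ->) (c & d & Hc & Hd & ->). exists (a + c), (b + d).
  split; [exact (is_series_plus _ _ _ _ Ha Hc) |].
  split; [exact (is_series_plus _ _ _ _ Hb Hd) | ring].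
Qed.

Lemma is_bsum_scal (k : C) (f : Z -> C) (l : C) :
  is_bsum f l -> is_bsum (fun n => k * f n) (k * l).
Proof.
  intros (a & b & Ha & Hb & ->). exists (k * a), (k * b).
  split; [exact (is_series_scal k _ _ Ha) |].
  split; [exact (is_series_scal k _ _ Hb) | ring].
Qed.

(** The shift moves the single term [f 0] from the non-negative half to the negative half, which
    accounts for the two witnesses. Reflection of the index below has the same bookkeeping, with the
    halves exchanged. *)
Lemma is_bsum_shift (f : Z -> C) (l : C) :
  is_bsum f l -> is_bsum (fun n => f (n + 1)%Z) l.
Proof.
  intros (a & b & Ha & Hb & ->). exists (a - f 0%Z), (b + f 0%Z).
  split; [| split; [| ring]].
  - eapply is_series_ext.
    2: { apply (is_series_incr_1 (V := C_NormedModule) (fun n => f (Z.of_nat n))).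
         replace (plus _ _) with a; [exact Ha |].
         change (a = a - f 0%Z + f 0%Z). ring. }
    intros n. cbv beta. f_equal. lia.
  - apply (is_series_decr_1 (V := C_NormedModule)).
    eapply is_series_ext.
    2: { replace (plus _ _) with b; [exact Hb |].
         change (b = b + f 0%Z + - f 0%Z). ring. }
    intros n. cbv beta. f_equal. lia.
Qed.

Lemma is_bsum_neg (f : Z -> C) (l : C) :
  is_bsum f l -> is_bsum (fun n => f (- n)%Z) l.
Proof.
  intros (a & b & Ha & Hb & ->). exists (b + f 0%Z), (a - f 0%Z).
  split; [| split; [| ring]].
  - apply (is_series_decr_1 (V := C_NormedModule)).
    eapply is_series_ext.
    2: { replace (plus _ _) with b; [exact Hb |].
         change (b = b + f 0%Z + - f 0%Z). ring. }
    intros n. cbv beta. f_equal.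
  - eapply is_series_ext.
    2: { apply (is_series_incr_1 (V := C_NormedModule) (fun n => f (Z.of_nat n))).
         replace (plus _ _) with a; [exact Ha |].
         change (a = a - f 0%Z + f 0%Z). ring. }
    intros n. cbv beta. f_equal.
Qed.

Lemma bconv_ext (f g : Z -> C) : (forall n, f n = g n) -> bconv f -> bconv g.
Proof.
  intros E H. destruct (bconv_is_bsum f H) as [l Hl].
  exact (is_bsum_bconv g l (is_bsum_ext f g l E Hl)).
Qed.

Lemma bconv_plus (f g : Z -> C) : bconv f -> bconv g -> bconv (fun n => f n + g n).
Proof.
  intros Hf Hg. destruct (bconv_is_bsum f Hf) as [l Hl], (bconv_is_bsum g Hg) as [m Hm].
  exact (is_bsum_bconv _ _ (is_bsum_plus f g l m Hl Hm)).
Qed.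

Lemma bconv_scal (k : C) (f : Z -> C) : bconv f -> bconv (fun n => k * f n).
Proof.
  intros Hf. destruct (bconv_is_bsum f Hf) as [l Hl].
  exact (is_bsum_bconv _ _ (is_bsum_scal k f l Hl)).
Qed.

Lemma bconv_csum (f : nat -> Z -> C) (N : nat) :
  (forall k, (k <= N)%nat -> bconv (f k)) -> bconv (fun n => csum (fun k => f k n) N).
Proof.
  induction N as [| N IH]; intros H; simpl; [apply H; lia |].
  apply bconv_plus; [apply IH; intros k Hk |]; apply H; lia.
Qed.

Lemma bsum_ext (f g : Z -> C) : (forall n, f n = g n) -> bsum f = bsum g.
Proof.
  intros E. unfold bsum. f_equal; f_equal; apply Series_ext; intros n; rewrite E; reflexivity.
Qed.

Lemma bsum_scal (k : C) (f : Z -> C) : bconv f -> bsum (fun n => k * f n) = k * bsum f.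
Proof. intros H. apply is_bsum_unique, is_bsum_scal, bconv_is_bsum_bsum, H. Qed.

Lemma bsum_shift (f : Z -> C) : bconv f -> bsum (fun n => f (n + 1)%Z) = bsum f.
Proof. intros H. apply is_bsum_unique, is_bsum_shift, bconv_is_bsum_bsum, H. Qed.

(** * Convergence from a first-order recurrence *)

Lemma ex_series_C_ratio (f : nat -> C) (r : R) (n0 : nat) : (0 <= r < 1)%R ->
  (forall n, (n0 <= n)%nat -> (Cmod (f (S n)) <= r * Cmod (f n))%R) ->
  ex_series (V := C_NormedModule) f.
Proof.
  intros Hr H.
  apply (ex_series_incr_n (V := C_NormedModule) f n0).
  apply (ex_series_le (V := C_CompleteNormedModule) _ (fun n => Cmod (f n0) * r ^ n)%R).
  - intros n. change (norm _) with (Cmod (f (n0 + n)%nat)).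
    induction n as [| n IH].
    + rewrite Nat.add_0_r. simpl. lra.
    + rewrite Nat.add_succ_r. eapply Rle_trans; [apply H; lia |].
      simpl. replace (Cmod (f n0) * (r * r ^ n))%R with (r * (Cmod (f n0) * r ^ n))%R by ring.
      apply Rmult_le_compat_l; [lra | exact IH].
  - apply (ex_series_scal (V := R_NormedModule)). exists (/ (1 - r))%R.
    apply is_series_geom. rewrite Rabs_pos_eq; lra.
Qed.

(** A ratio test without division: [f] may vanish anywhere, and [A] may vanish at the finitely many
    indices that precede its limiting behaviour. *)
Lemma ex_series_C_recurrence (f A B : nat -> C) (a b : R) :
  (forall n, f (S n) * A n = f n * B n) ->
  is_lim_seq (fun n => Cmod (A n)) a -> is_lim_seq (fun n => Cmod (B n)) b ->
  (0 <= b < a)%R -> ex_series (V := C_NormedModule) f.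
Proof.
  intros Hf HA HB Hab.
  (* The points at one third and two thirds of the way separate the limits, [b < b' < a' < a], so
     that [b' / a'] is an eventual ratio bound below 1. *)
  pose (a' := ((2 * a + b) / 3)%R). pose (b' := ((a + 2 * b) / 3)%R).
  assert (Hab' : (0 < b' < a' /\ a' < a /\ b < b')%R) by (unfold a', b'; lra).
  assert (E : eventually (fun n => (a' < Cmod (A n))%R /\ (Cmod (B n) < b')%R)).
  { apply filter_and.
    - apply (HA (fun y => a' < y)%R). apply (open_gt a' a). lra.
    - apply (HB (fun y => y < b')%R). apply (open_lt b' b). lra. }
  destruct E as [n0 E].
  apply (ex_series_C_ratio f (b' / a') n0).
  - split; [apply Rdiv_le_0_compat; lra |].
    apply (Rmult_lt_reg_r a'); [lra |]. unfold Rdiv. rewrite Rmult_assoc, Rinv_l; lra.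
  - intros n Hn. destruct (E n Hn) as [E1 E2].
    pose proof (f_equal Cmod (Hf n)) as Em. rewrite !Cmod_mult in Em.
    pose proof (Cmod_ge_0 (f n)). pose proof (Cmod_ge_0 (f (S n))).
    apply (Rmult_le_reg_r a'); [lra |].
    replace (b' / a' * Cmod (f n) * a')%R with (Cmod (f n) * b')%R by (field; lra).
    nra.
Qed.

Lemma is_lim_seq_Cmod_mult (f g : nat -> C) (a b : R) :
  is_lim_seq (fun n => Cmod (f n)) a -> is_lim_seq (fun n => Cmod (g n)) b ->
  is_lim_seq (fun n => Cmod (f n * g n)) (a * b)%R.
Proof.
  intros Hf Hg. eapply is_lim_seq_ext; [intros n; symmetry; apply Cmod_mult |].
  apply is_lim_seq_mult'; assumption.
Qed.

Lemma is_lim_seq_Cmod_minus (c z w : C) : (Cmod z < 1)%R ->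
  is_lim_seq (fun n => Cmod (c - w * z ^ n)) (Cmod c).
Proof.
  intros Hz.
  assert (G : is_lim_seq (fun n => Cmod w * Cmod z ^ n)%R 0%R).
  { replace 0%R with (Cmod w * 0)%R by ring. apply is_lim_seq_mult'.
    - apply is_lim_seq_const.
    - apply is_lim_seq_geom. rewrite Rabs_pos_eq; [exact Hz | apply Cmod_ge_0]. }
  apply is_lim_seq_le_le with
    (u := fun n => (Cmod c - Cmod w * Cmod z ^ n)%R)
    (w := fun n => (Cmod c + Cmod w * Cmod z ^ n)%R).
  - intros n. rewrite <- Cmod_pow, <- Cmod_mult. split.
    + pose proof (Cmod_triangle (c - w * z ^ n) (w * z ^ n)) as T.
      replace (c - w * z ^ n + w * z ^ n) with c in T by ring. lra.
    + unfold Cminus. rewrite <- (Cmod_opp (w * z ^ n)). apply Cmod_triangle.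
  - replace (Finite (Cmod c)) with (Finite (Cmod c - 0)) by (f_equal; ring).
    apply is_lim_seq_minus'; [apply is_lim_seq_const | exact G].
  - replace (Finite (Cmod c)) with (Finite (Cmod c + 0)) by (f_equal; ring).
    apply is_lim_seq_plus'; [apply is_lim_seq_const | exact G].
Qed.

(* At the negative end the recurrence is divided by [q^(2n)], which turns its four linear
   factors into [q^(-n) - b1], ..., with limits [- b1], ... *)
Lemma bconv_recurrence (lq b1 b2 a1 a2 w : C) (T : Z -> C) :
  (Cmod (Cexp lq) < 1)%R ->
  (forall n, T (n + 1)%Z * ((1 - b1 * qpow lq n) * (1 - b2 * qpow lq n))
             = T n * (w * ((1 - a1 * qpow lq n) * (1 - a2 * qpow lq n)))) ->
  (Cmod w < 1)%R -> (Cmod (b1 * b2) < Cmod (w * (a1 * a2)))%R ->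
  bconv T.
Proof.
  intros Hq HT Hw Hneg.
  assert (L1 : forall c : C, is_lim_seq (fun n => Cmod (1 - c * qpow lq (Z.of_nat n))) 1%R).
  { intros c. replace (Finite 1) with (Finite (Cmod 1)) by (f_equal; apply Cmod_1).
    eapply is_lim_seq_ext; [| apply (is_lim_seq_Cmod_minus 1 (Cexp lq) c Hq)].
    intros n. rewrite qpow_of_nat. reflexivity. }
  assert (L2 : forall c : C,
    is_lim_seq (fun n => Cmod (qpow lq (Z.of_nat n + 2) - c)) (Cmod c)).
  { intros c. rewrite <- (Cmod_opp c).
    eapply is_lim_seq_ext;
      [| apply (is_lim_seq_Cmod_minus (- c) (Cexp lq) (- qpow lq 2) Hq)].
    intros n. cbv beta. rewrite qpow_plus, qpow_of_nat. f_equal. ring. }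
  split.
  - apply ex_series_C_recurrence with
      (A := fun n => (1 - b1 * qpow lq (Z.of_nat n)) * (1 - b2 * qpow lq (Z.of_nat n)))
      (B := fun n => w * ((1 - a1 * qpow lq (Z.of_nat n)) * (1 - a2 * qpow lq (Z.of_nat n))))
      (a := (1 * 1)%R) (b := (Cmod w * (1 * 1))%R).
    + intros n. rewrite <- HT. f_equal. f_equal. lia.
    + apply is_lim_seq_Cmod_mult; apply L1.
    + apply (is_lim_seq_Cmod_mult (fun _ => w)); [apply is_lim_seq_const |].
      apply is_lim_seq_Cmod_mult; apply L1.
    + pose proof (Cmod_ge_0 w). lra.
  - apply ex_series_C_recurrence with
      (A := fun n => w * ((qpow lq (Z.of_nat n + 2) - a1) * (qpow lq (Z.of_nat n + 2) - a2)))
      (B := fun n => (qpow lq (Z.of_nat n + 2) - b1) * (qpow lq (Z.of_nat n + 2) - b2))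
      (a := (Cmod w * (Cmod a1 * Cmod a2))%R) (b := (Cmod b1 * Cmod b2)%R).
    + intros n.
      (* The [n]-th term of the negative half is [T (-(n+1))]. Its successor is [T m] with
         [m = -(n+2)], so the recurrence is read at [m] and the factors involve
         [q^(-m) = q^(n+2)]. *)
      pose (m := (- Z.of_nat (S (S n)))%Z).
      replace (- Z.of_nat (S n))%Z with (m + 1)%Z by (unfold m; lia).
      replace (Z.of_nat n + 2)%Z with (- m)%Z by (unfold m; lia).
      fold m. pose proof (HT m) as E. pose proof (qpow_opp_mult lq m) as Em.
      set (Q := qpow lq (- m)) in *. set (Qi := qpow lq m) in *.
      assert (F : forall c, Q - c = Q * (1 - c * Qi)).
      { intros c. replace (Q * (1 - c * Qi)) with (Q - c * (Q * Qi)) by ring.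
        rewrite Em. ring. }
      rewrite !F.
      transitivity (Q * Q * (T m * (w * ((1 - a1 * Qi) * (1 - a2 * Qi))))); [ring |].
      rewrite <- E. ring.
    + apply (is_lim_seq_Cmod_mult (fun _ => w)); [apply is_lim_seq_const |].
      apply is_lim_seq_Cmod_mult; apply L2.
    + apply is_lim_seq_Cmod_mult; apply L2.
    + rewrite !Cmod_mult in Hneg. split; [| exact Hneg].
      apply Rmult_le_pos; apply Cmod_ge_0.
Qed.

(** * Infinite q-products *)

(** The increments equal [- a q^n (a;q)_n], hence each is [q (1 - a q^n)] times its predecessor, a
    factor tending to [q]. The infinite product is thereby reduced to a series covered by the ratio
    test. *)
Lemma ex_series_qpoch_increments (lq a : C) : (Cmod (Cexp lq) < 1)%R ->
  ex_series (V := C_NormedModule) (fun n => qpoch lq a (S n) - qpoch lq a n).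
Proof.
  intros Hq.
  apply ex_series_C_recurrence with (A := fun _ => RtoC 1)
    (B := fun n => Cexp lq * (1 - a * Cexp lq ^ n)) (a := 1%R) (b := (Cmod (Cexp lq) * Cmod 1)%R).
  - intros n. cbn [qpoch]. unfold Cone. rewrite !qpow_of_nat, Cpow_S. ring.
  - rewrite Cmod_1. apply is_lim_seq_const.
  - apply (is_lim_seq_Cmod_mult (fun _ => Cexp lq)); [apply is_lim_seq_const |].
    apply is_lim_seq_Cmod_minus, Hq.
  - rewrite Cmod_1. pose proof (Cmod_ge_0 (Cexp lq)). lra.
Qed.

(** The increments sum to the limit minus [(a;q)_0 = 1], so the total [Lim_seq] inside [qinf] is a
    genuine finite limit. *)
Lemma is_lim_seq_qinf (lq a : C) : (Cmod (Cexp lq) < 1)%R ->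
  is_lim_seq (fun n => fst (qpoch lq a n)) (fst (qinf lq a)) /\
  is_lim_seq (fun n => snd (qpoch lq a n)) (snd (qinf lq a)).
Proof.
  intros Hq. destruct (ex_series_qpoch_increments lq a Hq) as [l Hl].
  destruct (is_series_C _ _ Hl) as [H1 H2].
  assert (S1 : forall n, sum_n (fun k => fst (qpoch lq a (S k) - qpoch lq a k)) n
                         = (fst (qpoch lq a (S n)) - 1)%R).
  { induction n as [| n IH]; [rewrite sum_O; reflexivity |].
    rewrite sum_Sn, IH. unfold plus, Cminus, Cplus, Copp; simpl. ring. }
  assert (S2 : forall n, sum_n (fun k => snd (qpoch lq a (S k) - qpoch lq a k)) n
                         = (snd (qpoch lq a (S n)) - 0)%R).
  { induction n as [| n IH]; [rewrite sum_O; reflexivity |].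
    rewrite sum_Sn, IH. unfold plus, Cminus, Cplus, Copp; simpl. ring. }
  split.
  - assert (L : is_lim_seq (fun n => fst (qpoch lq a n)) (fst l + 1)%R).
    { apply is_lim_seq_incr_1.
      apply is_lim_seq_ext with
        (u := fun n => (sum_n (fun k => fst (qpoch lq a (S k) - qpoch lq a k)%C) n + 1)%R).
      - intros n. rewrite S1. ring.
      - apply is_lim_seq_plus'; [exact H1 | apply is_lim_seq_const]. }
    unfold qinf; simpl. rewrite (is_lim_seq_unique _ _ L). exact L.
  - assert (L : is_lim_seq (fun n => snd (qpoch lq a n)) (snd l)).
    { apply is_lim_seq_incr_1.
      apply is_lim_seq_ext with
        (u := fun n => sum_n (fun k => snd (qpoch lq a (S k) - qpoch lq a k)) n).
      - intros n. rewrite S2. ring.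
      - exact H2. }
    unfold qinf; simpl. rewrite (is_lim_seq_unique _ _ L). exact L.
Qed.

Lemma qpoch_succ_l (lq a : C) (n : nat) :
  qpoch lq a (S n) = (1 - a) * qpoch lq (a * Cexp lq) n.
Proof.
  induction n as [| n IH].
  - simpl. rewrite qpow_0. unfold Cone. ring.
  - change (qpoch lq a (S (S n)))
      with (qpoch lq a (S n) * (Cone - a * qpow lq (Z.of_nat (S n)))).
    rewrite IH. cbn [qpoch]. rewrite !qpow_of_nat, Cpow_S. unfold Cone. ring.
Qed.

Lemma qinf_step (lq a : C) : (Cmod (Cexp lq) < 1)%R ->
  qinf lq a = (1 - a) * qinf lq (a * Cexp lq).
Proof.
  intros Hq.
  destruct (is_lim_seq_qinf lq a Hq) as [L1 L2].
  destruct (is_lim_seq_qinf lq (a * Cexp lq) Hq) as [M1 M2].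
  apply is_lim_seq_incr_1 in L1. apply is_lim_seq_incr_1 in L2.
  assert (K1 : is_lim_seq (fun n => fst (qpoch lq a (S n)))
                 (fst ((1 - a) * qinf lq (a * Cexp lq)))).
  { eapply is_lim_seq_ext; [intros n; rewrite qpoch_succ_l; reflexivity |].
    unfold Cmult; cbn [fst snd].
    apply is_lim_seq_minus'; apply is_lim_seq_mult'; try apply is_lim_seq_const; assumption. }
  assert (K2 : is_lim_seq (fun n => snd (qpoch lq a (S n)))
                 (snd ((1 - a) * qinf lq (a * Cexp lq)))).
  { eapply is_lim_seq_ext; [intros n; rewrite qpoch_succ_l; reflexivity |].
    unfold Cmult; cbn [fst snd].
    apply is_lim_seq_plus'; apply is_lim_seq_mult'; try apply is_lim_seq_const; assumption. }
  apply is_lim_seq_unique in L1, L2, K1, K2.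
  rewrite L1 in K1. rewrite L2 in K2. injection K1 as K1. injection K2 as K2.
  rewrite (surjective_pairing (qinf lq a)), (surjective_pairing (_ * _)).
  f_equal; assumption.
Qed.

Lemma inv_qinf_step (lq a : C) : (Cmod (Cexp lq) < 1)%R -> 1 - a <> 0 ->
  / qinf lq (a * Cexp lq) = (1 - a) * / qinf lq a.
Proof.
  intros Hq Ha. rewrite (qinf_step lq a Hq), Cinv_mult, Cmult_assoc, Cinv_r by exact Ha. ring.
Qed.

Lemma qpochZ_of_nat (lq a : C) (n : nat) : qpochZ lq a (Z.of_nat n) = qpoch lq a n.
Proof.
  destruct n as [| n]; [reflexivity |].
  simpl qpochZ. rewrite SuccNat2Pos.id_succ. reflexivity.
Qed.

Lemma qpochZ_opp_of_nat (lq a : C) (n : nat) :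
  qpochZ lq a (- Z.of_nat n) = / cprod1 (fun k => Cone - a * qpow lq (- Z.of_nat k)) n.
Proof.
  destruct n as [| n].
  - simpl. unfold Cone. field.
  - simpl qpochZ. rewrite SuccNat2Pos.id_succ. reflexivity.
Qed.

Lemma one_minus_neq_0 (c : C) : c <> Cone -> 1 - c <> 0.
Proof.
  intros H E. apply H. unfold Cone.
  transitivity (1 - (1 - c)); [ring |]. rewrite E. ring.
Qed.

(* For [n < 0] a vanishing factor makes both sides 0, thanks to [/ 0 = 0]. *)
Lemma qpochZ_inv_succ (lq a : C) (n : Z) :
  ((0 <= n)%Z -> a * qpow lq n <> Cone) ->
  / qpochZ lq a (n + 1) * (1 - a * qpow lq n) = / qpochZ lq a n.
Proof.
  intros H. destruct (Z_le_gt_dec 0 n) as [Hn | Hn].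
  - specialize (H Hn). apply one_minus_neq_0 in H.
    rewrite <- (Z2Nat.id n Hn) in *. set (m := Z.to_nat n) in *.
    replace (Z.of_nat m + 1)%Z with (Z.of_nat (S m)) by lia.
    rewrite !qpochZ_of_nat. cbn [qpoch]. unfold Cone. rewrite Cinv_mult.
    rewrite <- Cmult_assoc, Cinv_l, Cmult_1_r by exact H. reflexivity.
  - pose (m := Z.to_nat (- n - 1)).
    replace (n + 1)%Z with (- Z.of_nat m)%Z by (unfold m; lia).
    replace n with (- Z.of_nat (S m))%Z by (unfold m; lia).
    rewrite !qpochZ_opp_of_nat, !Cinv_inv. reflexivity.
Qed.

Lemma qpochZ_succ (lq a : C) (n : Z) : a * qpow lq n <> Cone ->
  qpochZ lq a (n + 1) = qpochZ lq a n * (1 - a * qpow lq n).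
Proof.
  intros H. pose proof (qpochZ_inv_succ lq a n (fun _ => H)) as E.
  apply (f_equal Cinv) in E. rewrite Cinv_mult, !Cinv_inv in E.
  rewrite <- E, <- Cmult_assoc, Cinv_l, Cmult_1_r; [reflexivity |].
  apply one_minus_neq_0, H.
Qed.

(** This absorbs the prefactor of [g_i] into the sum: a factor depending on [xi] and [n] becomes a
    function of [xi q^n]. For [n < 0] a factor [1 - a q^(-k)] may be zero, and then both sides
    vanish. *)
Lemma qinf_div_qpochZ (lq a : C) (n : Z) : (Cmod (Cexp lq) < 1)%R ->
  (forall k : nat, a * qpow lq (Z.of_nat k) <> Cone) ->
  qinf lq a * / qpochZ lq a n = qinf lq (a * qpow lq n).
Proof.
  intros Hq Ha.
  assert (S : forall m, qinf lq (a * qpow lq m)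
                        = (1 - a * qpow lq m) * qinf lq (a * qpow lq (m + 1))).
  { intros m. rewrite (qinf_step lq (a * qpow lq m) Hq), qpow_plus, qpow_1, Cmult_assoc.
    reflexivity. }
  assert (I : forall m, / qpochZ lq a (m + 1) * (1 - a * qpow lq m) = / qpochZ lq a m).
  { intros m. apply qpochZ_inv_succ. intros Hm. rewrite <- (Z2Nat.id m Hm). apply Ha. }
  assert (I0 : qinf lq a * / qpochZ lq a 0 = qinf lq (a * qpow lq 0)).
  { rewrite qpow_0, Cmult_1_r. simpl. unfold Cone. field. }
  destruct (Z_le_gt_dec 0 n) as [Hn | Hn].
  - rewrite <- (Z2Nat.id n Hn). generalize (Z.to_nat n) as m. clear n Hn.
    induction m as [| m IH]; [exact I0 |].
    replace (Z.of_nat (Datatypes.S m)) with (Z.of_nat m + 1)%Z by lia.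
    rewrite S, <- I in IH. pose proof (one_minus_neq_0 _ (Ha m)) as Hm.
    set (c := 1 - _) in *. set (d := / qpochZ lq a (Z.of_nat m + 1)) in *.
    transitivity (qinf lq a * (d * c) * / c);
      [field; exact Hm |]. rewrite IH. field. exact Hm.
  - replace n with (- Z.of_nat (Z.to_nat (- n)))%Z by lia.
    generalize (Z.to_nat (- n)) as m. clear n Hn.
    induction m as [| m IH]; [exact I0 |].
    rewrite S, <- I.
    replace (- Z.of_nat (Datatypes.S m) + 1)%Z with (- Z.of_nat m)%Z by lia.
    rewrite <- IH. ring.
Qed.

Lemma inv_qinf_mult_qpochZ (lq a : C) (n : Z) : (Cmod (Cexp lq) < 1)%R ->
  (forall k : nat, a * qpow lq (Z.of_nat k) <> Cone) ->
  / qinf lq a * qpochZ lq a n = / qinf lq (a * qpow lq n).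
Proof.
  intros Hq Ha. rewrite <- (qinf_div_qpochZ lq a n Hq Ha), Cinv_mult, Cinv_inv. reflexivity.
Qed.

(* The identity behind the telescoping: [K] stands for [q^k], the left-hand side is [A4]
   minus the three-term recurrence operator acting on the [k]-th term, the right-hand side is
   the difference of two consecutive values of the term times [e + f s + g s^2].  Comparing
   the coefficients of [s^0] and [s^4] gives [e] and [g], and then [s = q x] gives [f]. *)
Lemma kernel_identity (q Bt r t1 t2 H1 L1 H2 L2 p1 p2 nn K Q1 x s : C) :
  r <> 0 -> t1 <> 0 -> t2 <> 0 -> H1 <> 0 -> L1 <> 0 -> H2 <> 0 -> L2 <> 0 ->
  p1 <> 0 -> p2 <> 0 -> nn <> 0 -> K <> 0 -> x <> 0 ->
  q = r * r -> Bt = nn * nn * q * q * H2 * L1 * p2 / (H1 * L2 * p1) ->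
  let Q2 := Q1 / p1 * p2 * H2 / L2 * q * nn in
  let kap := Q1 / p1 in
  let b := L2 / H2 / nn in
  let b1 := r / L1 / t1 in
  let a1 := r / H1 / t1 in
  let A1 := H1 / H2 * L2 / q / nn * r * t1 in
  let A2 := L2 / q / nn * r * t2 in
  let B1 := L1 / r * t1 in
  let B2 := L2 / r * t2 in
  let C0 := (Q1 + Q2) * x + (Q1 * H1 * L2 / q / nn + Q1 * L1 * L2 * p2 / p1) * t1 * t2 / x in
  let X := t1 * t2 * (q / K * L1 * H2 * nn * p2) * (1 - K) * (1 - K / Bt) in
  let Y := r / K * nn * p2 * (L1 * t1 + H2 * t2) + K / r / nn * p1 * (H1 * t1 + L2 * t2) in
  let Z := nn * p2 / K * (1 - K / nn * p1 / p2) * (1 - K / nn) in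
  let e := kap * t1 * t2 * q / K * L1 * H2 * nn * p2 * (1 - K) in
  let g := kap * b / (x * a1) / K * Bt / q / q * p1 * (1 - K / nn) in
  let f := (q * Q2 * B1 * (x - B2) * (1 - b) - e - g * q * q * x * x) / (q * x) in
  Q1 / x * (x - A1) * (x - A2) * s * (1 - s / (q * x)) * (1 - s / x)
  + Q2 / x * (x - B1) * (x - B2) * s * (1 - b * s / x) * (1 - b * s / (q * x))
  - (C0 * s + kap * (X - Y * s + Z * (s * s))) * ((1 - b * s / x) * (1 - s / (q * x)))
  = K / Bt * (1 - s / (q * x)) * (1 - a1 * s) * (e + f * (q * s) + g * ((q * s) * (q * s)))
    - (1 - b * s / x) * (1 - b1 * s / q) * (e + f * s + g * (s * s)).
Proof.
  intros ? ? ? ? ? ? ? ? ? ? ? ? -> ->. cbv zeta. field. repeat split; assumption.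
Qed.

(** * Finite sums and general powers of [q] *)

Lemma csum_ext (f g : nat -> C) (N : nat) :
  (forall k, (k <= N)%nat -> f k = g k) -> csum f N = csum g N.
Proof.
  induction N as [| N IH]; intros H; simpl; [apply H; lia |].
  rewrite IH by (intros k Hk; apply H; lia). rewrite H by lia. reflexivity.
Qed.

Lemma csum_lin (a b : C) (f g : nat -> C) (N : nat) :
  csum (fun k => a * f k + b * g k) N = a * csum f N + b * csum g N.
Proof. induction N as [| N IH]; simpl; [| rewrite IH]; ring. Qed.

Lemma csum_scal (a : C) (f : nat -> C) (N : nat) :
  csum (fun k => a * f k) N = a * csum f N.
Proof. induction N as [| N IH]; simpl; [| rewrite IH]; ring. Qed.

Lemma cprod1_neq_0 (f : nat -> C) (n : nat) :
  (forall k, (k < n)%nat -> f (S k) <> 0) -> cprod1 f n <> 0.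
Proof.
  induction n as [| n IH]; intros H; cbn [cprod1].
  - unfold Cone. apply C1_nz.
  - apply Cmult_neq_0; [apply IH; intros k Hk |]; apply H; lia.
Qed.

Lemma cpow_plus (lq a b : C) : cpow lq (a + b) = cpow lq a * cpow lq b.
Proof. unfold cpow. rewrite Cmult_plus_distr_r. apply Cexp_plus. Qed.

Lemma cpow_opp (lq a : C) : cpow lq (- a) = / cpow lq a.
Proof. unfold cpow. rewrite <- Cexp_opp. f_equal. ring. Qed.

Lemma cpow_minus (lq a b : C) : cpow lq (a - b) = cpow lq a / cpow lq b.
Proof. unfold Cminus, Cdiv. rewrite cpow_plus, cpow_opp. reflexivity. Qed.

Lemma cpow_Cone (lq : C) : cpow lq Cone = Cexp lq.
Proof. unfold cpow, Cone. rewrite Cmult_1_l. reflexivity. Qed.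

Lemma cpow_neq_0 (lq a : C) : cpow lq a <> 0.
Proof. apply Cexp_neq_0. Qed.

Lemma cpow_INR (lq : C) (k : nat) : cpow lq (RtoC (INR k)) = Cexp lq ^ k.
Proof. rewrite <- qpow_of_nat. unfold cpow, qpow. rewrite INR_IZR_INZ. reflexivity. Qed.

Lemma Cmod_cpow_lt_1 (lq : C) (a : R) :
  (Cmod (Cexp lq) < 1)%R -> (0 < a)%R -> (Cmod (cpow lq (RtoC a)) < 1)%R.
Proof.
  intros Hq Ha. rewrite Cmod_Cexp in Hq. unfold cpow. rewrite Cmod_Cexp.
  rewrite <- exp_0 in *. apply exp_lt_inv in Hq. apply exp_increasing.
  unfold Cmult, RtoC; simpl. nra.
Qed.

Lemma Cmod_mult_lt (w z : C) : w <> 0 -> (Cmod z < 1)%R -> (Cmod (w * z) < Cmod w)%R.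
Proof.
  intros Hw Hz. apply Cmod_gt_0 in Hw. rewrite Cmod_mult.
  pose proof (Cmod_ge_0 z). nra.
Qed.

Lemma half_plus_half : Chalf + Chalf = Cone.
Proof. unfold Chalf, Cone. rewrite <- RtoC_plus. f_equal. field. Qed.

(** * The three-term recurrence *)

Section ThreeTerm.
Variables (lq t1 t2 h1 h2 l1 l2 al1 al2 be E : C).
Local Notation c := (cn lq t1 t2 h1 h2 l1 l2 al1 al2 be E).
Local Notation cp := (cpair lq t1 t2 h1 h2 l1 l2 al1 al2 be E).
Local Notation X := (xpp lq t1 t2 h1 h2 l1 l2 al1 al2 be).
Local Notation Y := (ypp lq t1 t2 h1 h2 l1 l2 al1 al2 be).
Local Notation Z := (zpp lq h1 h2 l1 l2 al1 al2 be).

Lemma cpair_succ (m : nat) :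
  cp (S m) = (c m, (c m * (E + Y (S m)) - fst (cp m) * Z (S m)) / X (S m)).
Proof. unfold cn. simpl. destruct (cp m). reflexivity. Qed.

Lemma cn_succ (m : nat) : X (S m) <> 0 ->
  c (S m) * X (S m) = c m * (E + Y (S m)) - fst (cp m) * Z (S m).
Proof.
  intros HX. unfold cn at 1. rewrite cpair_succ. simpl snd.
  set (x := X (S m)) in *. field. exact HX.
Qed.

Lemma xpp_0 : X 0%nat = 0.
Proof. unfold xpp. rewrite cpow_INR. simpl. unfold Cone. ring. Qed.

(** The coefficient of [s^(k+1)] is [c_(k+1) X_(k+1) - c_k Y_(k+1) + c_(k-1) Z_(k+1)], which the
    recurrence makes [E c_k], while [X_0 = 0] removes the constant term. Cutting the sum at [M]
    omits one [X] term and leaves one [Z] term over. *)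
Lemma csum_three_term (s : C) (M : nat) :
  (forall k, (k <= M)%nat -> X (S k) <> 0) ->
  csum (fun k => c k * (s ^ k * (X k - Y (S k) * s + Z (S (S k)) * (s * s)))) M
  = s * E * csum (fun k => c k * s ^ k) M
    - c (S M) * X (S M) * s ^ (S M) + c M * Z (S (S M)) * s ^ (S (S M)).
Proof.
  induction M as [| M IH]; intros HX.
  - cbn [csum]. rewrite (cn_succ 0) by (apply HX; lia). rewrite xpp_0.
    simpl. unfold cn, Czero, Cone; simpl. unfold Czero, Cone. ring.
  - cbn [csum]. rewrite IH by (intros k Hk; apply HX; lia).
    rewrite (cn_succ (S M)) by (apply HX; lia).
    rewrite (cpair_succ M). simpl fst. rewrite !Cpow_S. ring.
Qed.

Lemma csum_three_term_root (s : C) (N : nat) :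
  (forall k, X (S k) <> 0) ->
  Z (S (S N)) = 0 -> cpoly lq t1 t2 h1 h2 l1 l2 al1 al2 be E N = 0 ->
  csum (fun k => c k * (s ^ k * (X k - Y (S k) * s + Z (S (S k)) * (s * s)))) N
  = s * E * csum (fun k => c k * s ^ k) N.
Proof.
  intros HX HZ H0. rewrite csum_three_term by (intros; apply HX).
  (* [cpoly] is the non-zero product [X_1 ... X_N] times the right-hand side of the recurrence for
     [c_(N+1)], so a root of it kills the omitted term. *)
  assert (H1 : c (S N) * X (S N) = 0).
  { rewrite cn_succ by apply HX. unfold cpoly in H0.
    set (d := cprod1 _ _) in H0.
    assert (Hd : d <> 0) by (apply cprod1_neq_0; intros; apply HX).
    unfold cn. transitivity (/ d * (d * (snd (cp N) * (E + Y (S N)) - fst (cp N) * Z (S N)))).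
    - field. exact Hd.
    - rewrite H0. ring. }
  rewrite H1, HZ. ring.
Qed.
End ThreeTerm.

Lemma Cexp_plus_qpow (lq v : C) (n : Z) :
  Cexp (v + RtoC (IZR n) * lq) = Cexp v * qpow lq n.
Proof. apply Cexp_plus. Qed.

Lemma Cexp_INR_mult (k : nat) (w : C) : Cexp (RtoC (INR k) * w) = Cexp w ^ k.
Proof. apply (cpow_INR w k). Qed.

Lemma bsum_translate (lq v v' : C) (F : C -> C) :
  bconv (fun n => F (v + RtoC (IZR n) * lq)) ->
  v' = v \/ v' = v + lq \/ v' = v - lq ->
  bsum (fun n => F (v' + RtoC (IZR n) * lq)) = bsum (fun n => F (v + RtoC (IZR n) * lq)).
Proof.
  intros H [-> | [-> | ->]].
  - reflexivity.
  - rewrite <- (bsum_shift _ H). apply bsum_ext. intros n. f_equal.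
    rewrite plus_IZR, RtoC_plus. ring.
  (* The backward shift is the forward shift conjugated by [n -> -n]. *)
  - apply is_bsum_unique.
    eapply is_bsum_ext; [| apply is_bsum_neg, is_bsum_shift, is_bsum_neg, bconv_is_bsum_bsum, H].
    intros n. cbv beta. f_equal. repeat rewrite ?opp_IZR, ?plus_IZR, ?RtoC_opp, ?RtoC_plus. ring.
Qed.

(** * Telescoping *)

Section Eigenfunctions.
Variables (lq t1 t2 h1' h2' l1' l2' : C) (a1' a2' b' : R) (N : nat) (E0 al1 : C).
Hypothesis Hq : (Cmod (Cexp lq) < 1)%R.
Hypothesis Ht1 : t1 <> 0.
Hypothesis Ht2 : t2 <> 0.
Hypothesis HN :
  (h1' - h2' - l1' + l2' + RtoC a1' - RtoC a2' + RtoC b' - RtoC 2) / RtoC 2 = NC N.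
Hypothesis Hb' : (b' < 0)%R.
Hypothesis Ha' : (a1' < a2')%R.
Hypothesis Hroot : cpoly lq t1 t2 l1' h2' h1' l2' (RtoC a1') (RtoC a2') (RtoC b') E0 N = Czero.

(** Powers of [q] get short names, so that identities between exponents become rational identities.
    [Q1], [Q2] are [q^alpha_1], [q^alpha_2]; [A1], [A2], [B1], [B2] are the zeros in [x] of the
    coefficients of [A4]; [a1 xi], [b1 xi] and [b xi / x] are arguments of the products in [g_1]. *)
Local Notation q := (Cexp lq).
Local Notation P := (cpow lq).
Local Notation r := (P Chalf).
Local Notation H1 := (P h1').
Local Notation H2 := (P h2').
Local Notation L1 := (P l1').
Local Notation L2 := (P l2').
Local Notation p1 := (P (RtoC a1')).
Local Notation p2 := (P (RtoC a2')).
Local Notation Bt := (P (RtoC b')).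
Local Notation nn := (P (NC N)).
Local Notation Q1 := (P al1).
Local Notation c := (cc lq t1 t2 h1' h2' l1' l2' a1' a2' b' E0).
Local Notation b := (L2 / H2 / nn).
Local Notation b1 := (r / L1 / t1).
Local Notation a1 := (r / H1 / t1).
Local Notation Q2 := (Q1 / p1 * p2 * H2 / L2 * q * nn).
Local Notation A1 := (H1 / H2 * L2 / q / nn * r * t1).
Local Notation A2 := (L2 / q / nn * r * t2).
Local Notation B1 := (L1 / r * t1).
Local Notation B2 := (L2 / r * t2).

Local Ltac nz := repeat split; first [assumption | apply cpow_neq_0 | apply Cexp_neq_0 | apply Cpow_nz, Cexp_neq_0].

Local Ltac neq0 := unfold Cdiv;
  repeat match goal with
  | |- _ * _ <> _ => apply Cmult_neq_0
  | |- / _ <> _ => apply Cinv_neq_0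
  | |- _ ^ _ <> _ => apply Cpow_nz
  end; nz.

(** * Elimination of [beta'] and the recurrence coefficients as powers of [q] *)

Lemma q_half : q = r * r.
Proof. rewrite <- cpow_plus, half_plus_half, cpow_Cone. reflexivity. Qed.

(** The relation defining [N], solved for [beta']. *)
Lemma beta_eq : RtoC b' =
  NC N + NC N + Cone + Cone + h2' + l1' + RtoC a2' - (h1' + l2' + RtoC a1').
Proof.
  rewrite <- HN. unfold Cone.
  field.
Qed.

Lemma q_beta_eq : Bt = nn * nn * q * q * H2 * L1 * p2 / (H1 * L2 * p1).
Proof. rewrite beta_eq. rewrite cpow_minus, !cpow_plus, cpow_Cone. reflexivity. Qed.

(** This value makes the last factor of [z_n] equal to [1 - q^(n-2-N)], so the recurrence stops at
    [n = N + 2]. *)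
Lemma lam1_eq : lam1 l1' h2' h1' l2' (RtoC a1') (RtoC a2') (RtoC b') = - NC N - RtoC a2'.
Proof.
  unfold lam1. rewrite beta_eq. unfold Cone.
  field.
Qed.

Lemma xpp_eq (k : nat) :
  xpp lq t1 t2 l1' h2' h1' l2' (RtoC a1') (RtoC a2') (RtoC b') k
  = t1 * t2 * (q / q ^ k * L1 * H2 * nn * p2) * (1 - q ^ k) * (1 - q ^ k / Bt).
Proof.
  unfold xpp. rewrite lam1_eq.
  replace (Cone - RtoC (INR k) + l1' + h2' - (- NC N - RtoC a2'))
    with (Cone - RtoC (INR k) + l1' + h2' + NC N + RtoC a2') by ring.
  rewrite !cpow_plus, !cpow_minus, cpow_Cone, cpow_INR. unfold Cone. ring.
Qed.

Lemma ypp_eq (k : nat) :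
  ypp lq t1 t2 l1' h2' h1' l2' (RtoC a1') (RtoC a2') (RtoC b') (S k)
  = r / q ^ k * nn * p2 * (L1 * t1 + H2 * t2)
    + q ^ k / r / nn * p1 * (H1 * t1 + L2 * t2).
Proof.
  unfold ypp. rewrite lam1_eq, S_INR, RtoC_plus.
  replace (RtoC (3 / 2)) with (Cone + Chalf)
    by (unfold Cone, Chalf; rewrite <- RtoC_plus; f_equal; field).
  unfold Cone.
  replace (1 + Chalf - (RtoC (INR k) + 1) - (- NC N - RtoC a2'))
    with (Chalf - RtoC (INR k) + NC N + RtoC a2') by ring.
  replace (RtoC (INR k) + 1 - (1 + Chalf) + (- NC N - RtoC a2') + RtoC a1' + RtoC a2')
    with (RtoC (INR k) - Chalf - NC N + RtoC a1') by ring.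
  rewrite !cpow_plus, !cpow_minus, cpow_INR. reflexivity.
Qed.

Lemma zpp_eq (k : nat) :
  zpp lq l1' h2' h1' l2' (RtoC a1') (RtoC a2') (RtoC b') (S (S k))
  = nn * p2 / q ^ k * (1 - q ^ k / nn * p1 / p2) * (1 - q ^ k / nn).
Proof.
  unfold zpp. rewrite lam1_eq, !S_INR, !RtoC_plus.
  replace (RtoC 2) with (RtoC 1 + RtoC 1) by (rewrite <- RtoC_plus; reflexivity).
  replace (1 + 1 - (RtoC (INR k) + 1 + 1) - (- NC N - RtoC a2'))
    with (NC N + RtoC a2' - RtoC (INR k)) by ring.
  replace (RtoC (INR k) + 1 + 1 - (1 + 1) + (- NC N - RtoC a2') + RtoC a1')
    with (RtoC (INR k) - NC N + RtoC a1' - RtoC a2') by ring.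
  replace (RtoC (INR k) + 1 + 1 - (1 + 1) + (- NC N - RtoC a2') + RtoC a2')
    with (RtoC (INR k) - NC N) by ring.
  rewrite !cpow_minus, !cpow_plus, !cpow_minus, cpow_INR. reflexivity.
Qed.

(** For [n >= 1] both [n] and [n - beta'] are positive because [beta' < 0], so [q^n] and
    [q^(n-beta')] have modulus below 1 and cannot be 1. *)
Lemma xpp_neq_0 (k : nat) :
  xpp lq t1 t2 l1' h2' h1' l2' (RtoC a1') (RtoC a2') (RtoC b') (S k) <> 0.
Proof.
  assert (HK : forall z, (Cmod z < 1)%R -> 1 - z <> 0).
  { intros z Hz. apply one_minus_neq_0. intros ->. unfold Cone in Hz. rewrite Cmod_1 in Hz. lra. }
  pose proof (pos_INR k).
  unfold xpp. repeat apply Cmult_neq_0; try assumption; try apply cpow_neq_0; apply HK;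
    [| rewrite <- RtoC_minus]; apply Cmod_cpow_lt_1; try assumption; rewrite S_INR; lra.
Qed.

Lemma csum_recurrence (s : C) :
  csum (fun k => c k * (s ^ k *
    (t1 * t2 * (q / q ^ k * L1 * H2 * nn * p2) * (1 - q ^ k) * (1 - q ^ k / Bt)
     - (r / q ^ k * nn * p2 * (L1 * t1 + H2 * t2) + q ^ k / r / nn * p1 * (H1 * t1 + L2 * t2)) * s
     + nn * p2 / q ^ k * (1 - q ^ k / nn * p1 / p2) * (1 - q ^ k / nn) * (s * s)))) N
  = s * E0 * csum (fun k => c k * s ^ k) N.
Proof.
  etransitivity;
    [| apply (csum_three_term_root lq t1 t2 l1' h2' h1' l2' (RtoC a1') (RtoC a2') (RtoC b') E0 s N)].
  - apply csum_ext. intros k _. rewrite xpp_eq, ypp_eq, zpp_eq. reflexivity.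
  - apply xpp_neq_0.
  - rewrite zpp_eq, <- cpow_INR. fold (NC N). field. nz.
  - exact Hroot.
Qed.

(* [Psi] is the common factor of the three terms in [x/q], [x], [q x]: with
   [s = xi q^n] they are [Psi n] times the polynomials in [s] below. *)
Section Telescoping.
Variables (x xi : C) (Psi : Z -> C).
Hypothesis Hx : x <> 0.
Hypothesis Hxi : xi <> 0.
Local Notation s n := (xi * qpow lq n).
Hypothesis HPsi : forall n : Z,
  Psi (n + 1)%Z * ((1 - b * q * s n / x) * (1 - b1 * s n))
  = Psi n * (/ Bt * ((1 - s n / (q * x)) * (1 - a1 * s n))).
Local Notation p n := (csum (fun k => c k * s n ^ k) N).

(** Towards [+oo] successive terms have limiting ratio [q^(j-beta')], towards [-oo] it is
    [q^(N+4-j+alpha'_2-alpha'_1)]. The bound [N + 4] is the degree [N] of the sum of [c_k s^k] plus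
    the degree 4 of the polynomial factors in [boundary]; it still leaves a positive exponent at
    [-oo]. *)
Lemma bconv_Psi_pow (j : nat) : (j <= N + 4)%nat -> bconv (fun n => Psi n * s n ^ j).
Proof.
  intros Hj.
  pose proof (le_INR _ _ Hj) as Hj'. rewrite plus_INR in Hj'. simpl (INR 4) in Hj'.
  pose proof (pos_INR j).
  apply bconv_recurrence with (lq := lq) (b1 := b * q * xi / x) (b2 := b1 * xi)
    (a1 := xi / (q * x)) (a2 := a1 * xi) (w := / Bt * q ^ j).
  - exact Hq.
  - intros n. pose proof (HPsi n) as E. rewrite qpow_plus, qpow_1.
    replace (xi * (qpow lq n * q)) with (q * (s n)) by ring. rewrite Cpow_mult_l.
    set (Qn := qpow lq n) in *.
    transitivity (q ^ j * (xi * Qn) ^ j * (Psi (n + 1)%Z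
      * ((1 - b * q * (xi * Qn) / x) * (1 - b1 * (xi * Qn))))); [field; nz |].
    rewrite E. field. nz.
  - rewrite <- cpow_INR, <- cpow_opp, <- cpow_plus, <- RtoC_opp, <- RtoC_plus.
    apply Cmod_cpow_lt_1; [exact Hq | lra].
  - set (w0 := / Bt * q ^ j * _).
    replace (b * q * xi / x * (b1 * xi))
      with (w0 * P (RtoC (INR N + 4 - INR j + a2' - a1'))).
    + apply Cmod_mult_lt; [| apply Cmod_cpow_lt_1; [exact Hq | lra]].
      unfold w0. neq0.
    + unfold w0. rewrite q_beta_eq.
      replace (INR N + 4 - INR j + a2' - a1')%R
        with (INR N + 1 + 1 + 1 + 1 + a2' - a1' - INR j)%R by ring.
      rewrite !RtoC_minus, !RtoC_plus, !cpow_minus, !cpow_plus. fold (NC N) Cone.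
      rewrite cpow_Cone, cpow_INR. field. nz.
Qed.

Lemma bconv_Psi_poly (k : nat) (c0 c1 c2 c3 c4 : C) : (k <= N)%nat ->
  bconv (fun n => Psi n * (s n ^ k
    * (c0 + c1 * s n + c2 * s n ^ 2 + c3 * s n ^ 3 + c4 * s n ^ 4))).
Proof.
  intros Hk.
  apply bconv_ext with (f := fun n =>
    c0 * (Psi n * s n ^ (k + 0)) + c1 * (Psi n * s n ^ (k + 1)) + c2 * (Psi n * s n ^ (k + 2))
    + c3 * (Psi n * s n ^ (k + 3)) + c4 * (Psi n * s n ^ (k + 4))).
  - intros n. rewrite !Cpow_add_r. simpl. ring.
  - repeat apply bconv_plus; apply bconv_scal, bconv_Psi_pow; lia.
Qed.

(** The coefficients may vary with [k], as the [e], [f], [g] of the telescoping do through [q^k]. *)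
Lemma bconv_Psi_csum (u : nat -> C) (c0 c1 c2 c3 c4 : nat -> C) :
  bconv (fun n => Psi n * csum (fun k => u k * (s n ^ k
    * (c0 k + c1 k * s n + c2 k * s n ^ 2 + c3 k * s n ^ 3 + c4 k * s n ^ 4))) N).
Proof.
  apply bconv_ext with (f := fun n => csum (fun k => u k * (Psi n * (s n ^ k
    * (c0 k + c1 k * s n + c2 k * s n ^ 2 + c3 k * s n ^ 3 + c4 k * s n ^ 4)))) N).
  - intros n. rewrite <- csum_scal. apply csum_ext. intros k _. ring.
  - apply (bconv_csum (fun k n => u k * _)). intros k Hk.
    apply bconv_scal, bconv_Psi_poly, Hk.
Qed.

Definition termC (n : Z) : C := Psi n * (s n * (1 - b * s n / x) * (1 - s n / (q * x))) * p n.
Definition termL (n : Z) : C := Psi n * (s n * (1 - s n / x) * (1 - s n / (q * x))) * p n.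
Definition termR (n : Z) : C :=
  Psi n * (s n * (1 - b * s n / x) * (1 - b * s n / (q * x))) * p n.

Lemma bconv_quadratic (d1 d2 : C) :
  bconv (fun n => Psi n * (s n * (1 - d1 * s n) * (1 - d2 * s n)) * p n).
Proof.
  eapply bconv_ext; [| apply (bconv_Psi_csum c (fun _ => 0) (fun _ => 1)
    (fun _ => - (d1 + d2)) (fun _ => d1 * d2) (fun _ => 0))].
  intros n. cbv beta. rewrite <- (Cmult_assoc (Psi n)). f_equal.
  rewrite <- csum_scal. apply csum_ext. intros k _. simpl. ring.
Qed.

Lemma bconv_termC : bconv termC.
Proof.
  eapply bconv_ext; [| apply (bconv_quadratic (b / x) (/ (q * x)))].
  intros n. unfold termC, Cdiv. f_equal. ring.
Qed.

Lemma bconv_termL : bconv termL.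
Proof.
  eapply bconv_ext; [| apply (bconv_quadratic (/ x) (/ (q * x)))].
  intros n. unfold termL, Cdiv. f_equal. ring.
Qed.

Lemma bconv_termR : bconv termR.
Proof.
  eapply bconv_ext; [| apply (bconv_quadratic (b / x) (b / (q * x)))].
  intros n. unfold termR, Cdiv. f_equal. ring.
Qed.

Local Notation kap := (Q1 / p1).
Local Notation e K := (kap * t1 * t2 * q / K * L1 * H2 * nn * p2 * (1 - K)).
Local Notation g K := (kap * b / (x * a1) / K * Bt / q / q * p1 * (1 - K / nn)).
Local Notation f K := ((q * Q2 * B1 * (x - B2) * (1 - b) - e K - g K * q * q * x * x) / (q * x)).
Local Notation C0 := ((Q1 + Q2) * x
  + (Q1 * H1 * L2 / q / nn + Q1 * L1 * L2 * p2 / p1) * t1 * t2 / x).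

(** The two linear factors are chosen so that at [n + 1], where [s] becomes [q s], they are exactly
    the factors multiplying [Psi (n + 1)] in its recurrence. Both consecutive values are then
    multiples of [Psi n]. *)
Definition boundary (n : Z) : C := Psi n * ((1 - b * s n / x) * (1 - b1 * s n / q))
  * csum (fun k => c k * (s n ^ k * (e (q ^ k) + f (q ^ k) * s n + g (q ^ k) * (s n * s n)))) N.

Lemma bconv_boundary : bconv boundary.
Proof.
  eapply bconv_ext; [| apply (bconv_Psi_csum c
    (fun k => e (q ^ k))
    (fun k => f (q ^ k) - (b / x + b1 / q) * e (q ^ k))
    (fun k => g (q ^ k) - (b / x + b1 / q) * f (q ^ k) + b / x * (b1 / q) * e (q ^ k))
    (fun k => - (b / x + b1 / q) * g (q ^ k) + b / x * (b1 / q) * f (q ^ k))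
    (fun k => b / x * (b1 / q) * g (q ^ k)))].
  intros n. unfold boundary. cbv beta. rewrite <- (Cmult_assoc (Psi n)). f_equal.
  rewrite <- csum_scal. apply csum_ext. intros k _.
  generalize (e (q ^ k)) (f (q ^ k)) (g (q ^ k)) (b1). intros ek fk gk bb.
  simpl. unfold Cdiv. ring.
Qed.

Lemma term_telescopes (n : Z) :
  Q1 / x * (x - A1) * (x - A2) * termL n + Q2 / x * (x - B1) * (x - B2) * termR n
  - (C0 + kap * E0) * termC n
  = boundary (n + 1)%Z - boundary n.
Proof.
  unfold boundary at 1. rewrite qpow_plus, qpow_1.
  replace (xi * (qpow lq n * q)) with (q * s n) by ring.
  set (sn := s n) in *.
  replace (Psi (n + 1)%Z * ((1 - b * (q * sn) / x) * (1 - b1 * (q * sn) / q)))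
    with (Psi n * (/ Bt * ((1 - sn / (q * x)) * (1 - a1 * sn)))).
  2: { unfold sn. rewrite <- HPsi. fold sn. field. nz. }
  unfold boundary, termL, termR, termC. fold sn.
  pose proof (csum_recurrence sn) as R.
  set (pn := csum (fun k => c k * sn ^ k) N) in *.
  set (rec := csum _ N) in R at 1.
  (* [kernel_identity] is taken with [K = q^k], multiplied by [c_k s^k] and summed; the extra [q^k]
     on the left is what [(q s)^k] contributes to [boundary (n + 1)]. *)
  assert (KI : csum (fun k => c k * (sn ^ k * (
        / Bt * (1 - sn / (q * x)) * (1 - a1 * sn)
        * (q ^ k * (e (q ^ k) + f (q ^ k) * (q * sn) + g (q ^ k) * ((q * sn) * (q * sn))))
        - (1 - b * sn / x) * (1 - b1 * sn / q)
          * (e (q ^ k) + f (q ^ k) * sn + g (q ^ k) * (sn * sn))))) N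
    = (Q1 / x * (x - A1) * (x - A2) * sn * (1 - sn / (q * x)) * (1 - sn / x)
       + Q2 / x * (x - B1) * (x - B2) * sn * (1 - b * sn / x) * (1 - b * sn / (q * x))
       - C0 * sn * ((1 - b * sn / x) * (1 - sn / (q * x)))) * pn
      + (- kap * ((1 - b * sn / x) * (1 - sn / (q * x)))) * rec).
  { unfold pn, rec. rewrite <- csum_lin. apply csum_ext. intros k _.
    pose proof (kernel_identity q Bt r t1 t2 H1 L1 H2 L2 p1 p2 nn (q ^ k) Q1 x sn) as KI.
    cbv zeta in KI.
    transitivity (c k * (sn ^ k * (
      q ^ k / Bt * (1 - sn / (q * x)) * (1 - a1 * sn)
        * (e (q ^ k) + f (q ^ k) * (q * sn) + g (q ^ k) * ((q * sn) * (q * sn)))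
      - (1 - b * sn / x) * (1 - b1 * sn / q)
        * (e (q ^ k) + f (q ^ k) * sn + g (q ^ k) * (sn * sn))))).
    - unfold Cdiv. ring.
    - rewrite <- KI; try nz; [ring | apply q_half | apply q_beta_eq]. }
  (* The recurrence sum becomes [s E0] times the sum of [c_k s^k]; this is the source of the
     eigenvalue. *)
  rewrite R in KI.
  transitivity (Psi n *
    ((Q1 / x * (x - A1) * (x - A2) * sn * (1 - sn / (q * x)) * (1 - sn / x)
       + Q2 / x * (x - B1) * (x - B2) * sn * (1 - b * sn / x) * (1 - b * sn / (q * x))
       - C0 * sn * ((1 - b * sn / x) * (1 - sn / (q * x)))) * pn
      + (- kap * ((1 - b * sn / x) * (1 - sn / (q * x)))) * (sn * E0 * pn))); [ring |].
  rewrite <- KI.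
  transitivity (Psi n * (
    (/ Bt * ((1 - sn / (q * x)) * (1 - a1 * sn))) * csum (fun k => c k * ((q * sn) ^ k
       * (e (q ^ k) + f (q ^ k) * (q * sn) + g (q ^ k) * ((q * sn) * (q * sn))))) N
    + (- ((1 - b * sn / x) * (1 - b1 * sn / q))) * csum (fun k => c k * (sn ^ k
       * (e (q ^ k) + f (q ^ k) * sn + g (q ^ k) * (sn * sn)))) N)); [| ring].
  f_equal. rewrite <- csum_lin. apply csum_ext. intros k _. rewrite Cpow_mult_l.
  generalize (e (q ^ k)) (f (q ^ k)) (g (q ^ k)). intros ek fk gk. ring.
Qed.

(** No limit of [boundary] at either end is evaluated: [boundary] is itself summable and a bilateral
    sum is invariant under the shift, so its differences sum to 0. *)
Lemma bsum_eigen :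
  Q1 / x * (x - A1) * (x - A2) * bsum termL + Q2 / x * (x - B1) * (x - B2) * bsum termR
  - C0 * bsum termC = kap * E0 * bsum termC.
Proof.
  assert (T : is_bsum (fun n => boundary (n + 1)%Z + - (1) * boundary n)
                (bsum boundary + - (1) * bsum boundary)).
  { apply is_bsum_plus; [apply is_bsum_shift | apply is_bsum_scal];
      apply bconv_is_bsum_bsum, bconv_boundary. }
  assert (U : is_bsum (fun n => Q1 / x * (x - A1) * (x - A2) * termL n
      + Q2 / x * (x - B1) * (x - B2) * termR n + - (C0 + kap * E0) * termC n)
    (Q1 / x * (x - A1) * (x - A2) * bsum termL + Q2 / x * (x - B1) * (x - B2) * bsum termR
      + - (C0 + kap * E0) * bsum termC)).
  { repeat apply is_bsum_plus; apply is_bsum_scal, bconv_is_bsum_bsum;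
      [apply bconv_termL | apply bconv_termR | apply bconv_termC]. }
  assert (V : Q1 / x * (x - A1) * (x - A2) * bsum termL
      + Q2 / x * (x - B1) * (x - B2) * bsum termR + - (C0 + kap * E0) * bsum termC
    = bsum boundary + - (1) * bsum boundary).
  { rewrite <- (is_bsum_unique _ _ U). apply is_bsum_unique.
    eapply is_bsum_ext; [| exact T]. intros n. cbv beta.
    transitivity (boundary (n + 1)%Z - boundary n); [ring |].
    rewrite <- term_telescopes. ring. }
  transitivity (Q1 / x * (x - A1) * (x - A2) * bsum termL
    + Q2 / x * (x - B1) * (x - B2) * bsum termR + - (C0 + kap * E0) * bsum termC
    + kap * E0 * bsum termC); [ring |].
  rewrite V. ring.
Qed.
End Telescoping.

(** * From bilateral sums to the operator [A4] *)

(** The factors [Q1] and [/ Q1] are those that [x^(-alpha_1)] acquires under [x -> x/q] and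
    [x -> q x]. They turn the coefficients 1 and [q^(alpha_1+alpha_2)] of [A4] into [Q1] and
    [Q2]. *)
Lemma A4_of_terms (G : C -> C) (u xi : C) (Psi : Z -> C) :
  let x := Cexp u in
  xi <> 0 ->
  (forall n : Z,
    Psi (n + 1)%Z * ((1 - b * q * (xi * qpow lq n) / x) * (1 - b1 * (xi * qpow lq n)))
    = Psi n * (/ Bt * ((1 - xi * qpow lq n / (q * x)) * (1 - a1 * (xi * qpow lq n))))) ->
  G u = bsum (termC x xi Psi) ->
  G (u - lq) = Q1 * bsum (termL x xi Psi) ->
  G (u + lq) = / Q1 * bsum (termR x xi Psi) ->
  A4 lq t1 t2 (h1' - h2' + l2' - Cone - NC N) (l2' - Cone - NC N) l1' l2' al1
    (al1 - RtoC a1' + RtoC a2' + h2' - l2' + Cone + NC N)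
    (h1' - l1' + RtoC a1' - RtoC a2' - Cone - NC N) G u
  = P (al1 - RtoC a1') * E0 * G u.
Proof.
  intros x Hxi HPsi EC EL ER. unfold A4. rewrite EC, EL, ER. fold x.
  assert (Hx : x <> 0) by apply Cexp_neq_0.
  rewrite (cpow_minus lq al1), <- (bsum_eigen x xi Psi Hx Hxi HPsi).
  set (S := _ / RtoC 2). set (d := _ / RtoC 2). set (d' := - _ / RtoC 2).
  replace (P S * (P d + P d') * t1 * t2)
    with ((Q1 * H1 * L2 / q / nn + Q1 * L1 * L2 * p2 / p1) * t1 * t2).
  - repeat rewrite ?cpow_minus, ?cpow_plus. rewrite cpow_Cone. field. nz.
  (* Only the half-sums with [+beta] and with [-beta] occur, and in each of them the halves cancel,
     leaving the two monomials in [C0]. *)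
  - replace (P S * (P d + P d')) with (P (S + d) + P (S + d')) by (rewrite !cpow_plus; ring).
    replace (S + d) with (al1 + h1' + l2' - Cone - NC N) by (unfold S, d, Cone; field).
    replace (S + d') with (al1 + l1' + l2' + RtoC a2' - RtoC a1') by (unfold S, d', Cone; field).
    rewrite !cpow_minus, !cpow_plus, cpow_Cone. reflexivity.
Qed.

(** [F u w] is the summand with [u = log x] and [w = log s] independent. Shifting [u] by [lq] moves
    [vxi] by 0 or by the same [lq], so all three sums run over one orbit of [w] and can be compared
    at the fixed base point [v]. *)
Lemma A4_of_family (F : C -> C -> C) (g vxi : C -> C) (u : C) (Psi : Z -> C) :
  ((exists v0 : C, forall u, vxi u = v0) \/ (exists w : C, forall u, vxi u = w + u)) ->
  let x := Cexp u in
  let v := vxi u in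
  (forall n : Z,
    Psi (n + 1)%Z * ((1 - b * q * (Cexp v * qpow lq n) / x) * (1 - b1 * (Cexp v * qpow lq n)))
    = Psi n * (/ Bt * ((1 - Cexp v * qpow lq n / (q * x)) * (1 - a1 * (Cexp v * qpow lq n))))) ->
  g (u - lq) = bsum (fun n => F (u - lq) (vxi (u - lq) + RtoC (IZR n) * lq)) ->
  g u = bsum (fun n => F u (v + RtoC (IZR n) * lq)) ->
  g (u + lq) = bsum (fun n => F (u + lq) (vxi (u + lq) + RtoC (IZR n) * lq)) ->
  (forall n, F u (v + RtoC (IZR n) * lq) = termC x (Cexp v) Psi n) ->
  (forall n, F (u - lq) (v + RtoC (IZR n) * lq) = Q1 * termL x (Cexp v) Psi n) ->
  (forall n, F (u + lq) (v + RtoC (IZR n) * lq) = / Q1 * termR x (Cexp v) Psi n) ->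
  A4 lq t1 t2 (h1' - h2' + l2' - Cone - NC N) (l2' - Cone - NC N) l1' l2' al1
    (al1 - RtoC a1' + RtoC a2' + h2' - l2' + Cone + NC N)
    (h1' - l1' + RtoC a1' - RtoC a2' - Cone - NC N) g u
  = P (al1 - RtoC a1') * E0 * g u.
Proof.
  intros Hvxi x v HPsi GL GC GR FC FL FR.
  assert (EL : vxi (u - lq) = v \/ vxi (u - lq) = v + lq \/ vxi (u - lq) = v - lq).
  { unfold v. destruct Hvxi as [[v0 E] | [w E]]; rewrite !E; [left | right; right]; ring. }
  assert (ER : vxi (u + lq) = v \/ vxi (u + lq) = v + lq \/ vxi (u + lq) = v - lq).
  { unfold v. destruct Hvxi as [[v0 E] | [w E]]; rewrite !E; [left | right; left]; ring. }
  pose proof (Cexp_neq_0 u) as Hx. pose proof (Cexp_neq_0 v) as Hxi.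
  pose proof (bconv_termL _ _ _ Hx Hxi HPsi) as CL.
  pose proof (bconv_termR _ _ _ Hx Hxi HPsi) as CR.
  apply (A4_of_terms _ u (Cexp v) Psi Hxi HPsi).
  - rewrite GC. apply bsum_ext, FC.
  - rewrite GL, <- bsum_scal by exact CL. rewrite (bsum_translate lq v) with (2 := EL).
    + apply bsum_ext, FL.
    + eapply bconv_ext; [| apply (bconv_scal Q1), CL]. intros n. symmetry. apply FL.
  - rewrite GR, <- bsum_scal by exact CR. rewrite (bsum_translate lq v) with (2 := ER).
    + apply bsum_ext, FR.
    + eapply bconv_ext; [| apply (bconv_scal (/ Q1)), CR]. intros n. symmetry. apply FR.
Qed.

(** * The first solution *)

Lemma g1b2_factor : P (- h2' + l2' - NC N) = b.
Proof.
  replace (- h2' + l2' - NC N) with (l2' - h2' - NC N) by ring.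
  rewrite !cpow_minus. reflexivity.
Qed.

Lemma g1a1_eq (vxi : C -> C) (u : C) : g1a1 lq t1 h1' vxi u = a1 * Cexp (vxi u).
Proof.
  unfold g1a1. rewrite cpow_plus, cpow_opp. field. nz.
Qed.

Lemma g1b1_eq (vxi : C -> C) (u : C) : g1b1 lq t1 l1' vxi u = b1 * Cexp (vxi u).
Proof.
  unfold g1b1. rewrite cpow_plus, cpow_opp. field. nz.
Qed.

Lemma g1b2_eq (vxi : C -> C) (u : C) :
  g1b2 lq h2' l2' N vxi u = b * Cexp (vxi u) / Cexp u.
Proof. unfold g1b2. rewrite g1b2_factor. reflexivity. Qed.

(** The second argument is [log s] rather than [s]: the exponent [-beta' + 1 + k] need not be an
    integer, and the logarithm carries the branch. *)
Definition term1 (u w : C) : C :=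
  (1 - q) * Cexp (- al1 * u) * (qinf lq (b1 * Cexp w) * qinf lq (b * Cexp w / Cexp u))
  * (/ qinf lq (a1 * Cexp w) * / qinf lq (Cexp w / Cexp u))
  * csum (fun k => Cexp ((- RtoC b' + Cone + RtoC (INR k)) * w) * c k) N.

(** Among the three shifts of [x], the numerator product is taken from [x/q] and the inverse product
    from [q x]. Each of the three summands is then [Psi1] times finitely many linear factors in [s],
    with no denominator. *)
Definition Psi1 (u v : C) (n : Z) : C :=
  let s := Cexp v * qpow lq n in
  (1 - q) * Cexp (- al1 * u) * (qinf lq (b1 * s) * qinf lq (b * q * s / Cexp u))
  * (/ qinf lq (a1 * s) * / qinf lq (s / (q * Cexp u)))
  * Cexp (- RtoC b' * (v + RtoC (IZR n) * lq)).

Lemma csum_power1 (v : C) (n : Z) :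
  let w := v + RtoC (IZR n) * lq in
  csum (fun k => Cexp ((- RtoC b' + Cone + RtoC (INR k)) * w) * c k) N
  = Cexp (- RtoC b' * w) * (Cexp v * qpow lq n)
    * csum (fun k => c k * (Cexp v * qpow lq n) ^ k) N.
Proof.
  intros w. rewrite <- csum_scal. apply csum_ext. intros k _.
  rewrite !Cmult_plus_distr_r, !Cexp_plus, Cexp_INR_mult. unfold Cone. rewrite Cmult_1_l.
  unfold w. rewrite Cexp_plus_qpow. ring.
Qed.

Section FirstSolution.
Variables (u v : C).
Hypothesis Ha1 : forall n : Z, 1 - a1 * (Cexp v * qpow lq n) <> 0.
Hypothesis Ha2 : forall n : Z, 1 - Cexp v * qpow lq n / Cexp u <> 0.
Local Notation x := (Cexp u).
Local Notation s n := (Cexp v * qpow lq n).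

Lemma one_minus_pred_neq_0 (n : Z) : 1 - s n / (q * x) <> 0.
Proof.
  replace (s n / (q * x)) with (s (n - 1)%Z / x); [apply Ha2 |].
  pose proof (qpow_plus lq (n - 1) 1) as E. replace (n - 1 + 1)%Z with n in E by lia.
  rewrite E, qpow_1. field. nz.
Qed.

Lemma Psi1_recurrence (n : Z) :
  Psi1 u v (n + 1)%Z * ((1 - b * q * s n / x) * (1 - b1 * s n))
  = Psi1 u v n * (/ Bt * ((1 - s n / (q * x)) * (1 - a1 * s n))).
Proof.
  unfold Psi1. cbv zeta. rewrite qpow_plus, qpow_1.
  pose proof (Ha1 n) as N1. pose proof (one_minus_pred_neq_0 n) as N2.
  set (sn := s n) in *. replace (Cexp v * (qpow lq n * q)) with (sn * q) by (unfold sn; ring).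
  rewrite (qinf_step lq (b1 * sn) Hq), (qinf_step lq (b * q * sn / x) Hq).
  replace (a1 * (sn * q)) with (a1 * sn * q) by ring.
  replace (sn * q / (q * x)) with (sn / (q * x) * q) by (field; nz).
  rewrite (inv_qinf_step lq (a1 * sn) Hq N1), (inv_qinf_step lq (sn / (q * x)) Hq N2).
  replace (b1 * (sn * q)) with (b1 * sn * q) by ring.
  replace (b * q * (sn * q) / x) with (b * q * sn / x * q) by (field; nz).
  replace (- RtoC b' * (v + RtoC (IZR (n + 1)) * lq))
    with (- RtoC b' * (v + RtoC (IZR n) * lq) + - RtoC b' * lq)
    by (rewrite plus_IZR, RtoC_plus; ring).
  rewrite Cexp_plus. change (Cexp (- RtoC b' * lq)) with (P (- RtoC b')).
  rewrite cpow_opp. ring.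
Qed.

Lemma term1_center (n : Z) :
  term1 u (v + RtoC (IZR n) * lq) = termC x (Cexp v) (Psi1 u v) n.
Proof.
  unfold term1, termC, Psi1. rewrite csum_power1, Cexp_plus_qpow. cbv zeta.
  pose proof (one_minus_pred_neq_0 n) as N2. set (sn := s n) in *.
  rewrite (qinf_step lq (b * sn / x) Hq).
  replace (sn / x) with (sn / (q * x) * q) by (field; nz).
  rewrite (inv_qinf_step lq (sn / (q * x)) Hq N2).
  replace (b * sn / x * q) with (b * q * sn / x) by (field; nz). ring.
Qed.

Lemma term1_left (n : Z) :
  term1 (u - lq) (v + RtoC (IZR n) * lq) = Q1 * termL x (Cexp v) (Psi1 u v) n.
Proof.
  unfold term1, termL, Psi1. rewrite csum_power1, Cexp_plus_qpow. cbv zeta.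
  pose proof (one_minus_pred_neq_0 n) as N2. pose proof (Ha2 n) as N3. set (sn := s n) in *.
  replace (- al1 * (u - lq)) with (- al1 * u + al1 * lq) by ring.
  rewrite Cexp_plus, Cexp_minus.
  replace (sn / (x / q)) with (sn / x * q) by (field; nz).
  rewrite (inv_qinf_step lq (sn / x) Hq N3).
  replace (sn / x) with (sn / (q * x) * q) at 2 by (field; nz).
  rewrite (inv_qinf_step lq (sn / (q * x)) Hq N2).
  replace (b * sn / (x / q)) with (b * q * sn / x) by (field; nz).
  change (Cexp (al1 * lq)) with Q1. ring.
Qed.

Lemma term1_right (n : Z) :
  term1 (u + lq) (v + RtoC (IZR n) * lq) = / Q1 * termR x (Cexp v) (Psi1 u v) n.
Proof.
  unfold term1, termR, Psi1. rewrite csum_power1, Cexp_plus_qpow. cbv zeta.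
  set (sn := s n) in *.
  replace (- al1 * (u + lq)) with (- al1 * u + - al1 * lq) by ring.
  rewrite !Cexp_plus.
  rewrite (qinf_step lq (b * sn / (x * q)) Hq).
  replace (b * sn / (x * q) * q) with (b * sn / x) by (field; nz).
  rewrite (qinf_step lq (b * sn / x) Hq).
  replace (b * sn / x * q) with (b * q * sn / x) by (field; nz).
  change (Cexp (- al1 * lq)) with (P (- al1)). rewrite cpow_opp, (Cmult_comm x q). ring.
Qed.
End FirstSolution.

(** For each [k <= N] the limiting ratios are [q^(-beta'+1+k)] towards [+oo] and
    [q^(N+1-k+alpha'_2-alpha'_1)] towards [-oo]. *)
Lemma g1term_bconv (vxi : C -> C) (u : C) :
  nondeg1 lq t1 h1' h2' l1' l2' N vxi u ->
  bconv (g1term lq t1 t2 h1' h2' l1' l2' a1' a2' b' N E0 vxi u).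
Proof.
  intros [HA HB]. unfold g1term. cbv zeta.
  set (A := g1a1 _ _ _ _ _) in *. set (A' := g1a2 _ _) in *.
  set (B := g1b1 _ _ _ _ _) in *. set (B' := g1b2 _ _ _ _ _ _) in *.
  apply bconv_ext with (f := fun n => csum (fun k =>
    Cexp ((- RtoC b' + Cone + RtoC (INR k)) * vxi u) * c k
    * (qpochZ lq A n * qpochZ lq A' n * (/ qpochZ lq B n * / qpochZ lq B' n)
       * P ((- RtoC b' + Cone + RtoC (INR k)) * RtoC (IZR n)))) N).
  { intros n. rewrite <- csum_scal. apply csum_ext. intros k _.
    unfold Cdiv. rewrite Cinv_mult. ring. }
  apply (bconv_csum (fun k n => _ * _)). intros k Hk. apply bconv_scal.
  apply le_INR in Hk. pose proof (pos_INR k).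
  apply bconv_recurrence with (lq := lq) (b1 := B) (b2 := B') (a1 := A) (a2 := A')
    (w := P (- RtoC b' + Cone + RtoC (INR k))).
  - exact Hq.
  - intros n. rewrite !qpochZ_succ by apply HA.
    rewrite <- (qpochZ_inv_succ lq B n), <- (qpochZ_inv_succ lq B' n).
    2, 3: intros Hn; rewrite <- (Z2Nat.id n Hn); apply HB.
    rewrite plus_IZR, RtoC_plus, Cmult_plus_distr_l, cpow_plus, Cmult_1_r. ring.
  - unfold Cone. rewrite <- RtoC_opp, <- !RtoC_plus. apply Cmod_cpow_lt_1; [exact Hq | lra].
  - set (w := P (- RtoC b' + Cone + RtoC (INR k))).
    replace (B * B') with (w * (A * A') * P (RtoC (INR N + 1 - INR k + a2' - a1'))).
    + apply Cmod_mult_lt; [| apply Cmod_cpow_lt_1; [exact Hq | lra]].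
      unfold w, A, A'. rewrite g1a1_eq. unfold g1a2. neq0.
    + unfold w, A, A', B, B'. rewrite g1a1_eq, g1b1_eq, g1b2_eq. unfold g1a2.
      repeat rewrite ?RtoC_minus, ?RtoC_plus. repeat rewrite ?cpow_minus, ?cpow_plus, ?cpow_opp.
      rewrite q_beta_eq. fold (NC N) Cone. rewrite cpow_Cone. field. nz.
Qed.

Lemma g1_bsum (vxi : C -> C) (u : C) :
  nondeg1 lq t1 h1' h2' l1' l2' N vxi u ->
  g1 lq t1 t2 h1' h2' l1' l2' a1' a2' b' N E0 al1 vxi u
  = bsum (fun n => term1 u (vxi u + RtoC (IZR n) * lq)).
Proof.
  intros Hnd. pose proof (g1term_bconv vxi u Hnd) as Hc. destruct Hnd as [HA HB].
  unfold g1. cbv zeta. rewrite <- bsum_scal by exact Hc. apply bsum_ext. intros n.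
  unfold g1term. cbv zeta. unfold Cdiv. rewrite !Cinv_mult.
  set (v := vxi u). unfold term1. rewrite Cexp_plus_qpow.
  replace (b1 * (Cexp v * qpow lq n)) with (g1b1 lq t1 l1' vxi u * qpow lq n)
    by (rewrite g1b1_eq; fold v; ring).
  replace (a1 * (Cexp v * qpow lq n)) with (g1a1 lq t1 h1' vxi u * qpow lq n)
    by (rewrite g1a1_eq; fold v; ring).
  replace (b * (Cexp v * qpow lq n) / Cexp u) with (g1b2 lq h2' l2' N vxi u * qpow lq n)
    by (rewrite g1b2_eq; fold v; unfold Cdiv; ring).
  replace (Cexp v * qpow lq n / Cexp u) with (g1a2 vxi u * qpow lq n)
    by (unfold g1a2; fold v; unfold Cdiv; ring).
  rewrite <- (qinf_div_qpochZ lq (g1b1 lq t1 l1' vxi u) n Hq) by (intros k; apply HB).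
  rewrite <- (qinf_div_qpochZ lq (g1b2 lq h2' l2' N vxi u) n Hq) by (intros k; apply HB).
  rewrite <- (inv_qinf_mult_qpochZ lq (g1a1 lq t1 h1' vxi u) n Hq) by (intros k; apply HA).
  rewrite <- (inv_qinf_mult_qpochZ lq (g1a2 vxi u) n Hq) by (intros k; apply HA).
  set (S := csum _ N). set (S' := csum _ N).
  replace S' with S; [unfold Cone; ring |].
  apply csum_ext. intros k _. f_equal. unfold cpow. rewrite <- Cexp_plus. f_equal. fold v. ring.
Qed.

Lemma A4_g1 (vxi : C -> C) (u : C) :
  ((exists v0 : C, forall u, vxi u = v0) \/ (exists w : C, forall u, vxi u = w + u)) ->
  nondeg1 lq t1 h1' h2' l1' l2' N vxi (u - lq) ->
  nondeg1 lq t1 h1' h2' l1' l2' N vxi u ->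
  nondeg1 lq t1 h1' h2' l1' l2' N vxi (u + lq) ->
  A4 lq t1 t2 (h1' - h2' + l2' - Cone - NC N) (l2' - Cone - NC N) l1' l2' al1
    (al1 - RtoC a1' + RtoC a2' + h2' - l2' + Cone + NC N)
    (h1' - l1' + RtoC a1' - RtoC a2' - Cone - NC N)
    (g1 lq t1 t2 h1' h2' l1' l2' a1' a2' b' N E0 al1 vxi) u
  = P (al1 - RtoC a1') * E0 * g1 lq t1 t2 h1' h2' l1' l2' a1' a2' b' N E0 al1 vxi u.
Proof.
  intros Hvxi HL HC HR. pose (v := vxi u).
  assert (N1 : forall n : Z, 1 - a1 * (Cexp v * qpow lq n) <> 0).
  { intros n. destruct HC as [HA _]. apply one_minus_neq_0.
    rewrite Cmult_assoc. unfold v. rewrite <- g1a1_eq. apply HA. }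
  assert (N2 : forall n : Z, 1 - Cexp v * qpow lq n / Cexp u <> 0).
  { intros n. destruct HC as [HA _]. apply one_minus_neq_0.
    replace (Cexp v * qpow lq n / Cexp u) with (g1a2 vxi u * qpow lq n)
      by (unfold g1a2; fold v; unfold Cdiv; ring).
    apply HA. }
  apply (A4_of_family term1 _ vxi u (Psi1 u v) Hvxi).
  - apply (Psi1_recurrence u v N1 N2).
  - apply g1_bsum, HL.
  - apply g1_bsum, HC.
  - apply g1_bsum, HR.
  - intros n. apply term1_center, N2.
  - intros n. apply term1_left, N2.
  - intros n. apply term1_right.
Qed.

(** * The second solution *)

Lemma g2c1_eq (vxi : C -> C) (u : C) : g2c1 lq t1 h1' vxi u = q / (a1 * Cexp (vxi u)).
Proof. unfold g2c1. rewrite cpow_plus, q_half. field. nz. Qed.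

Lemma g2d1_eq (vxi : C -> C) (u : C) : g2d1 lq t1 l1' vxi u = q / (b1 * Cexp (vxi u)).
Proof. unfold g2d1. rewrite cpow_plus, q_half. field. nz. Qed.

Lemma g2d2_eq (vxi : C -> C) (u : C) :
  g2d2 lq h2' l2' N vxi u = q * Cexp u / (b * Cexp (vxi u)).
Proof.
  unfold g2d2. repeat rewrite ?cpow_plus, ?cpow_minus. rewrite cpow_Cone. field. nz.
Qed.

Definition term2 (u w : C) : C :=
  (1 - q) * Cexp ((- al1 - h2' + l2' - NC N) * u)
  * (qinf lq (q / (a1 * Cexp w)) * qinf lq (q * Cexp u / Cexp w))
  * (/ qinf lq (q / (b1 * Cexp w)) * / qinf lq (q * Cexp u / (b * Cexp w)))
  * csum (fun k => Cexp ((RtoC a1' - RtoC a2' - Cone - NC N + RtoC (INR k)) * w) * c k) N.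

(** The products now have arguments in [1/s], so the numerator comes from [q x] and the inverse
    product from [x/q]. Rewriting each of the two split-off linear factors by
    [1 - 1/z = -(1 - z)/z], and dividing by the [s] present in [termC], leaves the monomial
    [q x^2 / (b s^3)]. *)
Definition Psi2 (u v : C) (n : Z) : C :=
  let s := Cexp v * qpow lq n in
  (1 - q) * Cexp ((- al1 - h2' + l2' - NC N) * u)
  * (qinf lq (q / (a1 * s)) * qinf lq (q * q * Cexp u / s))
  * (/ qinf lq (q / (b1 * s)) * / qinf lq (Cexp u / (b * s)))
  * (q * Cexp u * Cexp u / b / (s * s * s))
  * Cexp ((RtoC a1' - RtoC a2' - Cone - NC N) * (v + RtoC (IZR n) * lq)).

Lemma csum_power2 (v : C) (n : Z) :
  let w := v + RtoC (IZR n) * lq in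
  csum (fun k => Cexp ((RtoC a1' - RtoC a2' - Cone - NC N + RtoC (INR k)) * w) * c k) N
  = Cexp ((RtoC a1' - RtoC a2' - Cone - NC N) * w)
    * csum (fun k => c k * (Cexp v * qpow lq n) ^ k) N.
Proof.
  intros w. rewrite <- csum_scal. apply csum_ext. intros k _.
  rewrite Cmult_plus_distr_r, Cexp_plus, Cexp_INR_mult.
  unfold w. rewrite Cexp_plus_qpow. ring.
Qed.

Section SecondSolution.
Variables (u v : C).
Hypothesis Hb1 : forall n : Z, 1 - / (b1 * (Cexp v * qpow lq n)) <> 0.
Hypothesis Hb2 : forall n : Z, 1 - Cexp u / (b * (Cexp v * qpow lq n)) <> 0.
Local Notation x := (Cexp u).
Local Notation s n := (Cexp v * qpow lq n).

Lemma s_neq_0 (n : Z) : s n <> 0.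
Proof. apply Cmult_neq_0; apply Cexp_neq_0. Qed.

(** Turning the four linear factors in [1/s] into factors in [s] produces [q^2 b b1 / a1]. Together
    with [q^(-3)] from the monomial and [q^(alpha'_1-alpha'_2-1-N)] from the power this is [/ Bt],
    by the relation defining [N]; hence the recurrence agrees with that of [Psi1]. *)
Lemma Psi2_recurrence (n : Z) :
  Psi2 u v (n + 1)%Z * ((1 - b * q * s n / x) * (1 - b1 * s n))
  = Psi2 u v n * (/ Bt * ((1 - s n / (q * x)) * (1 - a1 * s n))).
Proof.
  pose proof (Hb1 n) as N1. pose proof (Hb2 (n + 1)%Z) as N2. pose proof (s_neq_0 n) as Hs.
  unfold Psi2. cbv zeta. rewrite qpow_plus, qpow_1 in *.
  set (sn := s n) in *.
  replace (Cexp v * (qpow lq n * q)) with (sn * q) in * by (unfold sn; ring).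
  replace (q / (a1 * (sn * q))) with (/ (a1 * sn)) by (field; nz).
  replace (q * q * x / (sn * q)) with (q * x / sn) by (field; nz).
  replace (q / (b1 * (sn * q))) with (/ (b1 * sn)) by (field; nz).
  rewrite (qinf_step lq (/ (a1 * sn)) Hq), (qinf_step lq (q * x / sn) Hq).
  replace (q / (b1 * sn)) with (/ (b1 * sn) * q) by (field; nz).
  rewrite (inv_qinf_step lq (/ (b1 * sn)) Hq N1).
  replace (x / (b * sn)) with (x / (b * (sn * q)) * q) by (field; nz).
  rewrite (inv_qinf_step lq (x / (b * (sn * q))) Hq N2).
  replace (q / (a1 * sn)) with (/ (a1 * sn) * q) by (field; nz).
  replace (q * q * x / sn) with (q * x / sn * q) by (field; nz).
  replace ((RtoC a1' - RtoC a2' - Cone - NC N) * (v + RtoC (IZR (n + 1)) * lq))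
    with ((RtoC a1' - RtoC a2' - Cone - NC N) * (v + RtoC (IZR n) * lq)
          + (RtoC a1' - RtoC a2' - Cone - NC N) * lq)
    by (rewrite plus_IZR, RtoC_plus; ring).
  rewrite Cexp_plus.
  change (Cexp ((RtoC a1' - RtoC a2' - Cone - NC N) * lq))
    with (P (RtoC a1' - RtoC a2' - Cone - NC N)).
  rewrite !cpow_minus, cpow_Cone, q_beta_eq.
  generalize (/ qinf lq (/ (b1 * sn))) (/ qinf lq (x / (b * (sn * q))))
    (qinf lq (/ (a1 * sn) * q)) (qinf lq (q * x / sn * q)). intros i1 i2 i3 i4.
  generalize (Cexp ((RtoC a1' - RtoC a2' - Cone - NC N) * (v + RtoC (IZR n) * lq)))
    (Cexp ((- al1 - h2' + l2' - NC N) * u)). intros i5 i6.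
  field. nz.
Qed.

Lemma term2_center (n : Z) :
  term2 u (v + RtoC (IZR n) * lq) = termC x (Cexp v) (Psi2 u v) n.
Proof.
  pose proof (Hb2 n) as N2. pose proof (s_neq_0 n) as Hs.
  unfold term2, termC, Psi2. rewrite csum_power2, Cexp_plus_qpow. cbv zeta.
  set (sn := s n) in *.
  rewrite (qinf_step lq (q * x / sn) Hq).
  replace (q * x / (b * sn)) with (x / (b * sn) * q) by (field; nz).
  rewrite (inv_qinf_step lq (x / (b * sn)) Hq N2).
  replace (q * x / sn * q) with (q * q * x / sn) by (field; nz).
  generalize (/ qinf lq (q / (b1 * sn))) (/ qinf lq (x / (b * sn))). intros i1 i2.
  field. nz.
Qed.

Lemma term2_left (n : Z) :
  term2 (u - lq) (v + RtoC (IZR n) * lq) = Q1 * termL x (Cexp v) (Psi2 u v) n.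
Proof.
  pose proof (s_neq_0 n) as Hs.
  unfold term2, termL, Psi2. rewrite csum_power2, Cexp_plus_qpow. cbv zeta.
  set (sn := s n) in *.
  replace ((- al1 - h2' + l2' - NC N) * (u - lq))
    with ((- al1 - h2' + l2' - NC N) * u + (al1 + h2' - l2' + NC N) * lq) by ring.
  rewrite Cexp_plus, Cexp_minus.
  change (Cexp ((al1 + h2' - l2' + NC N) * lq)) with (P (al1 + h2' - l2' + NC N)).
  rewrite cpow_plus, cpow_minus, cpow_plus.
  replace (q * (x / q) / sn) with (x / sn) by (field; nz).
  replace (q * (x / q) / (b * sn)) with (x / (b * sn)) by (field; nz).
  rewrite (qinf_step lq (x / sn) Hq).
  replace (x / sn * q) with (q * x / sn) by (field; nz).
  rewrite (qinf_step lq (q * x / sn) Hq).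
  replace (q * x / sn * q) with (q * q * x / sn) by (field; nz).
  generalize (/ qinf lq (q / (b1 * sn))) (/ qinf lq (x / (b * sn))). intros i1 i2.
  field. nz.
Qed.

Lemma term2_right (n : Z) :
  term2 (u + lq) (v + RtoC (IZR n) * lq) = / Q1 * termR x (Cexp v) (Psi2 u v) n.
Proof.
  pose proof (Hb2 n) as N2. pose proof (Hb2 (n - 1)%Z) as N3. pose proof (s_neq_0 n) as Hs.
  unfold term2, termR, Psi2. rewrite csum_power2, Cexp_plus_qpow. cbv zeta.
  pose proof (qpow_plus lq (n - 1) 1) as Eq. replace (n - 1 + 1)%Z with n in Eq by lia.
  rewrite qpow_1 in Eq.
  replace (x / (b * s (n - 1)%Z)) with (x / (b * s n) * q) in N3
    by (rewrite Eq; field; nz; apply qpow_neq_0).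
  set (sn := s n) in *.
  replace ((- al1 - h2' + l2' - NC N) * (u + lq))
    with ((- al1 - h2' + l2' - NC N) * u + (l2' - al1 - h2' - NC N) * lq) by ring.
  rewrite !Cexp_plus.
  change (Cexp ((l2' - al1 - h2' - NC N) * lq)) with (P (l2' - al1 - h2' - NC N)).
  rewrite !cpow_minus.
  replace (q * (x * q) / (b * sn)) with (x / (b * sn) * q * q) by (field; nz).
  rewrite (inv_qinf_step lq _ Hq N3), (inv_qinf_step lq _ Hq N2).
  replace (q * (x * q) / sn) with (q * q * x / sn) by (field; nz).
  generalize (/ qinf lq (q / (b1 * sn))) (/ qinf lq (x / (b * sn))). intros i1 i2.
  field. nz.
Qed.
End SecondSolution.

(** The two ends exchange roles compared with the first solution: the ratio is
    [q^(alpha'_2-alpha'_1+1+N-k)] towards [+oo] and [q^(1+k-beta')] towards [-oo]. *)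
Lemma g2term_bconv (vxi : C -> C) (u : C) :
  nondeg2 lq t1 h1' h2' l1' l2' N vxi u ->
  bconv (g2term lq t1 t2 h1' h2' l1' l2' a1' a2' b' N E0 vxi u).
Proof.
  intros [HA HB]. unfold g2term. cbv zeta.
  set (A := g2d1 _ _ _ _ _) in *. set (A' := g2d2 _ _ _ _ _ _) in *.
  set (B := g2c1 _ _ _ _ _) in *. set (B' := g2c2 _ _ _) in *.
  apply bconv_ext with (f := fun n => csum (fun k =>
    Cexp ((RtoC a1' - RtoC a2' - Cone - NC N + RtoC (INR k)) * vxi u) * c k
    * (qpochZ lq A n * qpochZ lq A' n * (/ qpochZ lq B n * / qpochZ lq B' n)
       * P ((- RtoC a1' + RtoC a2' + Cone + NC N - RtoC (INR k)) * RtoC (IZR n)))) N).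
  { intros n. rewrite <- csum_scal. apply csum_ext. intros k _.
    unfold Cdiv. rewrite Cinv_mult. ring. }
  apply (bconv_csum (fun k n => _ * _)). intros k Hk. apply bconv_scal.
  apply le_INR in Hk. pose proof (pos_INR k).
  apply bconv_recurrence with (lq := lq) (b1 := B) (b2 := B') (a1 := A) (a2 := A')
    (w := P (- RtoC a1' + RtoC a2' + Cone + NC N - RtoC (INR k))).
  - exact Hq.
  - intros n. rewrite !qpochZ_succ by apply HA.
    rewrite <- (qpochZ_inv_succ lq B n), <- (qpochZ_inv_succ lq B' n).
    2, 3: intros Hn; rewrite <- (Z2Nat.id n Hn); apply HB.
    rewrite plus_IZR, RtoC_plus, Cmult_plus_distr_l, cpow_plus, Cmult_1_r. ring.
  - unfold Cone, NC. rewrite <- RtoC_opp, <- !RtoC_plus, <- RtoC_minus.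
    apply Cmod_cpow_lt_1; [exact Hq | lra].
  - set (w := P (- RtoC a1' + RtoC a2' + Cone + NC N - RtoC (INR k))).
    replace (B * B') with (w * (A * A') * P (RtoC (1 + INR k - b'))).
    + apply Cmod_mult_lt; [| apply Cmod_cpow_lt_1; [exact Hq | lra]].
      unfold w, A, A'. rewrite g2d1_eq, g2d2_eq. neq0.
    + unfold w, A, A', B, B'. rewrite g2c1_eq, g2d1_eq, g2d2_eq. unfold g2c2.
      repeat rewrite ?RtoC_minus, ?RtoC_plus. repeat rewrite ?cpow_minus, ?cpow_plus, ?cpow_opp.
      rewrite q_beta_eq. fold Cone. rewrite cpow_Cone. field. nz.
Qed.

Lemma g2_bsum (vxi : C -> C) (u : C) :
  nondeg2 lq t1 h1' h2' l1' l2' N vxi u ->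
  g2 lq t1 t2 h1' h2' l1' l2' a1' a2' b' N E0 al1 vxi u
  = bsum (fun n => term2 u (vxi u + RtoC (IZR n) * lq)).
Proof.
  intros Hnd. pose proof (g2term_bconv vxi u Hnd) as Hc. destruct Hnd as [HA HB].
  symmetry. apply is_bsum_unique. unfold g2. cbv zeta.
  (* The [n]-th term belongs to [s = xi q^(-n)]; reversing the index gives the orientation shared
     with the first solution. *)
  eapply is_bsum_ext; [| apply is_bsum_neg, is_bsum_scal, bconv_is_bsum_bsum, Hc].
  intros m. cbv beta. pose (n := (- m)%Z). fold n.
  replace (RtoC (IZR m)) with (- RtoC (IZR n)) by (unfold n; rewrite opp_IZR, RtoC_opp; ring).
  unfold g2term. cbv zeta. unfold Cdiv. rewrite !Cinv_mult.
  set (v := vxi u). unfold term2.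
  assert (Ew : Cexp (v + - RtoC (IZR n) * lq) = Cexp v * / qpow lq n).
  { rewrite Cexp_plus. f_equal. unfold qpow. rewrite <- Cexp_opp. f_equal. ring. }
  rewrite Ew. pose proof (qpow_neq_0 lq n) as Hn. pose proof (Cexp_neq_0 v) as Hv.
  replace (q / (b1 * (Cexp v * / qpow lq n))) with (g2d1 lq t1 l1' vxi u * qpow lq n)
    by (rewrite g2d1_eq; fold v; field; nz).
  replace (q / (a1 * (Cexp v * / qpow lq n))) with (g2c1 lq t1 h1' vxi u * qpow lq n)
    by (rewrite g2c1_eq; fold v; field; nz).
  replace (q * Cexp u / (b * (Cexp v * / qpow lq n)))
    with (g2d2 lq h2' l2' N vxi u * qpow lq n)
    by (rewrite g2d2_eq; fold v; field; nz).
  replace (q * Cexp u / (Cexp v * / qpow lq n)) with (g2c2 lq vxi u * qpow lq n)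
    by (unfold g2c2; fold v; field; nz).
  rewrite <- (qinf_div_qpochZ lq (g2c1 lq t1 h1' vxi u) n Hq) by (intros k; apply HB).
  rewrite <- (qinf_div_qpochZ lq (g2c2 lq vxi u) n Hq) by (intros k; apply HB).
  rewrite <- (inv_qinf_mult_qpochZ lq (g2d1 lq t1 l1' vxi u) n Hq) by (intros k; apply HA).
  rewrite <- (inv_qinf_mult_qpochZ lq (g2d2 lq h2' l2' N vxi u) n Hq) by (intros k; apply HA).
  set (S := csum _ N). set (S' := csum _ N).
  replace S' with S; [unfold Cone; ring |].
  apply csum_ext. intros k _. f_equal. unfold cpow. rewrite <- Cexp_plus. f_equal. fold v. ring.
Qed.

Lemma A4_g2 (vxi : C -> C) (u : C) :
  ((exists v0 : C, forall u, vxi u = v0) \/ (exists w : C, forall u, vxi u = w + u)) ->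
  nondeg2 lq t1 h1' h2' l1' l2' N vxi (u - lq) ->
  nondeg2 lq t1 h1' h2' l1' l2' N vxi u ->
  nondeg2 lq t1 h1' h2' l1' l2' N vxi (u + lq) ->
  A4 lq t1 t2 (h1' - h2' + l2' - Cone - NC N) (l2' - Cone - NC N) l1' l2' al1
    (al1 - RtoC a1' + RtoC a2' + h2' - l2' + Cone + NC N)
    (h1' - l1' + RtoC a1' - RtoC a2' - Cone - NC N)
    (g2 lq t1 t2 h1' h2' l1' l2' a1' a2' b' N E0 al1 vxi) u
  = P (al1 - RtoC a1') * E0 * g2 lq t1 t2 h1' h2' l1' l2' a1' a2' b' N E0 al1 vxi u.
Proof.
  intros Hvxi HL HC HR. pose (v := vxi u). pose proof (Cexp_neq_0 v) as Hv.
  (* The arguments [d_i] carry a factor [q] and run opposite to [s], so [1 / (b1 s)] and [x / (b s)]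
     at index [n] are [d_1] and [d_2] times [q^(-n-1)]. *)
  assert (Eq : forall n, qpow lq (- n - 1) = / (q * qpow lq n)).
  { intros n. unfold qpow. rewrite <- Cexp_plus, <- Cexp_opp. f_equal.
    rewrite minus_IZR, opp_IZR, RtoC_minus, RtoC_opp. ring. }
  assert (N1 : forall n : Z, 1 - / (b1 * (Cexp v * qpow lq n)) <> 0).
  { intros n. destruct HC as [HA _]. apply one_minus_neq_0.
    replace (/ (b1 * (Cexp v * qpow lq n))) with (g2d1 lq t1 l1' vxi u * qpow lq (- n - 1)).
    - apply HA.
    - rewrite g2d1_eq, Eq. fold v. pose proof (qpow_neq_0 lq n). field. nz. }
  assert (N2 : forall n : Z, 1 - Cexp u / (b * (Cexp v * qpow lq n)) <> 0).
  { intros n. destruct HC as [HA _]. apply one_minus_neq_0.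
    replace (Cexp u / (b * (Cexp v * qpow lq n)))
      with (g2d2 lq h2' l2' N vxi u * qpow lq (- n - 1)).
    - apply HA.
    - rewrite g2d2_eq, Eq. fold v. pose proof (qpow_neq_0 lq n). field. nz. }
  apply (A4_of_family term2 _ vxi u (Psi2 u v) Hvxi).
  - apply (Psi2_recurrence u v N1 N2).
  - apply g2_bsum, HL.
  - apply g2_bsum, HC.
  - apply g2_bsum, HR.
  - intros n. apply term2_center, N2.
  - intros n. apply term2_left.
  - intros n. apply term2_right, N2.
Qed.
End Eigenfunctions.

Theorem theorem3p2
  (q lq t1 t2 : C) (h1' h2' l1' l2' : C) (a1' a2' b' : R) (N : nat)
  (E0 al1 : C) (vxi : C -> C) :
  Cexp lq = q -> (0 < Cmod q < 1)%R ->
  t1 <> Czero -> t2 <> Czero ->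
  (* N = (h'_1 - h'_2 - l'_1 + l'_2 + alpha'_1 - alpha'_2 + beta' - 2)/2 *)
  (h1' - h2' - l1' + l2' + RtoC a1' - RtoC a2' + RtoC b' - RtoC 2) / RtoC 2 = NC N ->
  (b' < 0)%R -> (a1' < a2')%R ->
  (* c(E'_0) = 0 *)
  cpoly lq t1 t2 l1' h2' h1' l2' (RtoC a1') (RtoC a2') (RtoC b') E0 N = Czero ->
  (* xi = Cexp (vxi u) at x = Cexp u: either independent of x, or xi = A x *)
  ((exists v0 : C, forall u, vxi u = v0) \/ (exists w : C, forall u, vxi u = w + u)) ->
  let al2 := al1 - RtoC a1' + RtoC a2' + h2' - l2' + Cone + NC N in
  let be := h1' - l1' + RtoC a1' - RtoC a2' - Cone - NC N in
  let l1 := l1' in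
  let l2 := l2' in
  let h1 := h1' - h2' + l2' - Cone - NC N in
  let h2 := l2' - Cone - NC N in
  let E := cpow lq (al1 - RtoC a1') * E0 in
  let G1 := g1 lq t1 t2 h1' h2' l1' l2' a1' a2' b' N E0 al1 vxi in
  let G2 := g2 lq t1 t2 h1' h2' l1' l2' a1' a2' b' N E0 al1 vxi in
  (forall u, nondeg1 lq t1 h1' h2' l1' l2' N vxi u ->
     bconv (g1term lq t1 t2 h1' h2' l1' l2' a1' a2' b' N E0 vxi u)) /\
  (forall u, nondeg2 lq t1 h1' h2' l1' l2' N vxi u ->
     bconv (g2term lq t1 t2 h1' h2' l1' l2' a1' a2' b' N E0 vxi u)) /\
  (forall u,
     nondeg1 lq t1 h1' h2' l1' l2' N vxi (u - lq) ->
     nondeg1 lq t1 h1' h2' l1' l2' N vxi u ->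
     nondeg1 lq t1 h1' h2' l1' l2' N vxi (u + lq) ->
     A4 lq t1 t2 h1 h2 l1 l2 al1 al2 be G1 u = E * G1 u) /\
  (forall u,
     nondeg2 lq t1 h1' h2' l1' l2' N vxi (u - lq) ->
     nondeg2 lq t1 h1' h2' l1' l2' N vxi u ->
     nondeg2 lq t1 h1' h2' l1' l2' N vxi (u + lq) ->
     A4 lq t1 t2 h1 h2 l1 l2 al1 al2 be G2 u = E * G2 u).
Proof.
  intros Hlq Hq Ht1 Ht2 HN Hb Ha Hroot Hvxi. cbv zeta.
  assert (Hq1 : (Cmod (Cexp lq) < 1)%R) by (rewrite Hlq; apply Hq).
  split; [| split; [| split]].
  - intros u Hu. apply g1term_bconv; assumption.
  - intros u Hu. apply g2term_bconv; assumption.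
  - intros u HL HC HR. apply A4_g1; assumption.
  - intros u HL HC HR. apply A4_g2; assumption.
Qed.
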